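(* Let $\Omega\subset\partial_\infty\mathbb H^2\times\mathbb R$ be a bounded convex $C^{2,\alpha}$ domain for some $0<\alpha<1$, let $\Gamma=\partial\Omega$ and let $f\in C^{2,\alpha}(\Gamma)$ be a positive function. Let $\epsilon\in[0,1]$, and let $\ell:[0,1]\to\mathbb R$ be a continuous function with $0\le\ell(s)\le1$ for all $s$, $\ell(1)=1$ and $\ell(s)=0$ for $s\in[0,1/2]$. Given $s\in[1/2,1]$, let $g_s\in C^{2,\alpha}(\overline\Omega)$ be a positive solution $g=g_s$ in $\Omega$ of $$g_{xx}(g^2+g_t^2+\epsilon)+g_{tt}(1+g_x^2)-2g_xg_tg_{xt}+\ell(s)\,g(1+g_x^2)=0$$ such that $g_s=(2s-1)f+2(1-s)\min_\Gamma f$ on $\Gamma$. Assume further that $$R(\Omega,f)\le\min_\Gamma f+\min_\Gamma f\,\sqrt{\frac{\pi}{2}} .$$ Then $$\max_{\overline\Omega}|Dg_s|\le C,$$ where $C$ is a constant depending only on $\min_\Gamma f$, $\max_\Gamma f$, $\max_{\Omega}x-\min_{\Omega}x$ and $K$ (the constant $K$ being defined in the context).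
   Context: Upper half-plane model: $\mathbb H^2=\{(x,y): y>0\}$, and $\partial_\infty\mathbb H^2\times\mathbb R$ is identified with $\mathbb R\times\mathbb R=\mathbb R^2$ with coordinates $(x,t)$ and the Euclidean metric. A $C^0$ domain $\Omega$ is convex if for every $p\in\partial\Omega$ there is a line $\Pi$ of $\mathbb R^2$ with $p\in\Pi\cap\partial\Omega$, $\Pi\cap\Omega=\emptyset$ and $\Omega$ lying on one side of $\Pi$. $R(\Omega,f)=\sqrt{\max_\Gamma f^2+(h(\Gamma)/2)^2}$, where $h(\Gamma)=\max_\Gamma x-\min_\Gamma x$. The quantity $\max_\Omega x-\min_\Omega x$ is the horizontal width of $\Omega$ (extrema taken on $\overline\Omega$). Definition of $K$: for $s\in[1/2,1]$ let $\widehat\varphi_s\in C^{2,\alpha}(\overline\Omega)$ be the unique solution in $\Omega$ of the Euclidean minimal equation $\operatorname{div}\big(\nabla u/\sqrt{1+|\nabla u|^2}\big)=0$ with $\widehat\varphi_s=(2s-1)f+2(1-s)\min_\Gamma f$ on $\Gamma$. It is known that there is a constant $K$, independent of $s\in[1/2,1]$, such that $\max_{\overline\Omega}|D\widehat\varphi_s|+\max_{\overline\Omega}|D^2\widehat\varphi_s|\le K$ for all $s\in[1/2,1]$; $K$ denotes such a constant. *)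

(* Defs.v *)
From HB Require Import structures.
From mathcomp Require Import all_boot all_order all_algebra.
From mathcomp Require Import all_classical all_reals all_analysis.

Set Implicit Arguments.
Unset Strict Implicit.
Unset Printing Implicit Defensive.

Import Order.TTheory GRing.Theory Num.Theory.
Import numFieldNormedType.Exports.

Local Open Scope classical_set_scope.
Local Open Scope ring_scope.

(* The plane ∂_∞ H² x R is R * R, a point p having coordinates x = p.1 and
   t = p.2.  The norm of the product is the sup norm, which gives the right
   topology and bounded sets; lengths use the Euclidean norm below. *)

Section Extrema.
Context {R : realType} {T : Type}.
Implicit Types (A : set T) (F : T -> R).

(* These are used for continuous F and nonempty compact A only, where they are
   attained. *)
Definition max_on A F : R := sup [set F p | p in A].
Definition min_on A F : R := inf [set F p | p in A].

End Extrema.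

Section Plane.
Context {R : realType}.
Local Notation plane := (R * R)%type.
Implicit Types (Om : set plane) (u h f : plane -> R) (p q e : plane).

Definition enorm p : R := Num.sqrt (p.1 ^+ 2 + p.2 ^+ 2).

Definition bdry Om : set plane := closure Om `\` interior Om.

Definition dx u : plane -> R := fun p => 'D_((1, 0) : plane) u p.
Definition dt u : plane -> R := fun p => 'D_((0, 1) : plane) u p.

Definition has_partials Om u :=
  forall p, Om p ->
    derivable u p ((1, 0) : plane) /\ derivable u p ((0, 1) : plane).

(* Continuous extension of h from Om to its closure: h on Om, limits of h on
   the boundary. *)
Definition ext Om h : plane -> R := fun p => lim (h q @[q --> within Om (nbhs p)]).

Definition extends_continuously Om h :=
  exists2 h' : plane -> R,
    {within closure Om, continuous h'} & forall p, Om p -> h' p = h p.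

Definition holder_on (alpha : R) Om h :=
  exists A : R, forall p q, Om p -> Om q ->
    `|h p - h q| <= A * (enorm (p - q)) `^ alpha.

(* The space C^{2,alpha} of the closure of a bounded open set Om.  Only the
   values of u on the closure matter; derivatives are taken in Om and reach
   the boundary through ext. *)
Record C2alpha_closure (alpha : R) Om u : Prop := {
  C2a_cont : {within closure Om, continuous u} ;
  C2a_partials : has_partials Om u ;
  C2a_partials_dx : has_partials Om (dx u) ;
  C2a_partials_dt : has_partials Om (dt u) ;
  C2a_ext1 : extends_continuously Om (dx u) /\ extends_continuously Om (dt u) ;
  C2a_ext2 :
    [/\ extends_continuously Om (dx (dx u)), extends_continuously Om (dt (dx u)),
        extends_continuously Om (dx (dt u)) & extends_continuously Om (dt (dt u))] ;
  C2a_holder2 :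
    [/\ holder_on alpha Om (dx (dx u)), holder_on alpha Om (dt (dx u)),
        holder_on alpha Om (dx (dt u)) & holder_on alpha Om (dt (dt u))] }.

(* |Du| and the Euclidean (Frobenius) norm |D^2u| on the closure of Om. *)
Definition norm_D Om u : plane -> R := fun p =>
  Num.sqrt (ext Om (dx u) p ^+ 2 + ext Om (dt u) p ^+ 2).
Definition norm_D2 Om u : plane -> R := fun p =>
  Num.sqrt (ext Om (dx (dx u)) p ^+ 2 + ext Om (dt (dx u)) p ^+ 2 +
            ext Om (dx (dt u)) p ^+ 2 + ext Om (dt (dt u)) p ^+ 2).

(* C^{2,alpha} functions of one variable on ]-r, r[. *)
Definition C2alpha_interval (alpha r : R) (k : R -> R) :=
  [/\ forall y, `|y| < r -> derivable k y 1,
      forall y, `|y| < r -> derivable (derive1 k) y 1 &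
      exists A : R, forall y z, `|y| < r -> `|z| < r ->
        `|derive1 (derive1 k) y - derive1 (derive1 k) z| <= A * `|y - z| `^ alpha].

(* The point p + y e + z e^perp. *)
Definition frame_pt p e (y z : R) : plane :=
  (p.1 + y * e.1 - z * e.2, p.2 + y * e.2 + z * e.1).

(* In the box |y| < r, |z| < r' of the orthonormal frame (p; e, e^perp), Om is
   the strict epigraph of eta, so that bdry Om is there the graph of eta. *)
Record C2alpha_chart (alpha : R) Om p e (r r' : R) (eta : R -> R) : Prop := {
  chart_unit : enorm e = 1 ;
  chart_radii : 0 < r /\ 0 < r' ;
  chart_smooth : C2alpha_interval alpha r eta ;
  chart_base : eta 0 = 0 ;
  chart_height : forall y, `|y| < r -> `|eta y| < r' ;
  chart_epigraph : forall y z, `|y| < r -> `|z| < r' ->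
    (Om (frame_pt p e y z) <-> eta y < z) }.

Record bounded_C2alpha_domain (alpha : R) Om : Prop := {
  dom_nonempty : Om !=set0 ;
  dom_open : open Om ;
  dom_connected : connected Om ;
  dom_bounded : bounded_set Om ;
  dom_charts : forall p, bdry Om p ->
    exists e r r' eta, C2alpha_chart alpha Om p e r r' eta }.

(* f is of class C^{2,alpha} along the boundary, read in the graph
   parametrizations y |-> p + y e + eta(y) e^perp; only the values of f on
   bdry Om matter. *)
Definition C2alpha_bdry (alpha : R) Om f :=
  forall p, bdry Om p -> exists e r r' eta,
    C2alpha_chart alpha Om p e r r' eta /\
    C2alpha_interval alpha r (fun y => f (frame_pt p e y (eta y))).

(* Through every boundary point p there is a line a x + b t = c which does not
   meet Om and leaves Om on one side, a x + b t < c up to the sign of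
   (a, b, c). *)
Definition convex_domain Om :=
  forall p, bdry Om p -> exists a b c : R,
    [/\ (a, b) != (0, 0), a * p.1 + b * p.2 = c &
        forall q, Om q -> a * q.1 + b * q.2 < c].

(* max x - min x over A: the horizontal width of Om for A = closure Om, and
   h(Gamma) for A = Gamma. *)
Definition x_extent (A : set plane) : R := max_on A fst - min_on A fst.

Definition Rradius Om f : R :=
  Num.sqrt (max_on (bdry Om) (fun p => f p ^+ 2) +
            (x_extent (bdry Om) / 2) ^+ 2).

Definition bdry_data Om f (s : R) : plane -> R := fun p =>
  (2 * s - 1) * f p + 2 * (1 - s) * min_on (bdry Om) f.

Definition area_elt u : plane -> R := fun p =>
  Num.sqrt (1 + (dx u p ^+ 2 + dt u p ^+ 2)).

(* div (grad u / sqrt (1 + |grad u|^2)) = 0 in Om. *)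
Definition euclidean_minimal Om u :=
  forall p, Om p ->
    dx (fun q => dx u q / area_elt u q) p +
    dt (fun q => dt u q / area_elt u q) p = 0.

Definition solves_euclidean (alpha : R) Om f (s : R) u :=
  [/\ C2alpha_closure alpha Om u, euclidean_minimal Om u &
      forall p, bdry Om p -> u p = bdry_data Om f s p].

(* l stands for the number ell(s). *)
Definition hyperbolic_eq (eps l : R) Om u :=
  forall p, Om p ->
    dx (dx u) p * (u p ^+ 2 + dt u p ^+ 2 + eps)
    + dt (dt u) p * (1 + dx u p ^+ 2)
    - 2 * dx u p * dt u p * dt (dx u) p
    + l * u p * (1 + dx u p ^+ 2) = 0.

End Plane.

(* Main.v *)
Require Import Defs.
From HB Require Import structures.
From mathcomp Require Import all_boot all_order all_algebra.
From mathcomp Require Import all_classical all_reals all_analysis.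
From mathcomp Require Import ring lra.

Import Order.TTheory GRing.Theory Num.Theory.
Import numFieldNormedType.Exports.

Local Open Scope classical_set_scope.
Local Open Scope ring_scope.

(** The maximum principle gives min f <= g, and, applied to g^2 + (x - x0)^2,
    a bound g <= M.  On the boundary, exp(nu u) - k d with u = g - phi or
    phi - g and d the distance to a supporting line has no interior maximum
    once nu is large, since the principal part evaluated at Du is at least
    c |Du|^2; this bounds |g - phi| by a multiple of d.

    In the interior no third derivatives are available, so v = g^3/3 is
    compared at two points: if v(p) - v(q) - L |p - q| has a positive interior
    maximum, then Dv(p) = Dv(q) = L e with e = (p - q)/|p - q|.  The equation
    for v has coefficients g^4 diag(g^2 + eps, 1) + L^2 n (x) n, n orthogonal
    to e, and a zeroth order part whose increment is at least
    c L^2 (g(p) - g(q)).  Coupling the Cholesky factors of the two coefficient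
    matrices bounds the second order difference by
    C (g(p) - g(q))^2 / (L |p - q|), which is too small if v is already
    2L-Lipschitz.  So the (a priori uncontrolled) Lipschitz constant of v can be
    halved until it reaches an explicit value. *)

(** Why the cube: for v = g^k/k with Dv = L e, the same computation gives the zeroth order part L^2
    (k - 1 - l) e_1^2 g^k + L^2 (k - 1) (eps e_1^2 + e_2^2) g^(k-2) - l g^(3k-2). For k = 2 the
    first coefficient vanishes at l = 1 and the e_2 term no longer depends on g. With k = 3 both
    terms increase strictly for every l in [0, 1], and a large L beats the last one. The part of the
    coefficients that grows with the gradient depends only on Dv. It is therefore identical at the
    two points and drops out of the coupling; what remains varies with g alone. The constant may
    depend on Om only through its horizontal width. Convexity keeps the curvature of the boundary
    out, since the distance to a supporting line is affine and contributes its gradient only. The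
    width itself enters through horizontal moves to the boundary. The regularity of g up to the
    boundary is used qualitatively: it decides how many halvings are made, not where they end. *)

(** * Second order expansions at 0 of functions of one variable *)

Section Jets.
Context {R : realType}.
Implicit Types (h : R -> R) (a b : R).

(* The remainder is carried by a function k continuous at 0, which makes the
   rules below algebraic identities. *)
Definition jet h a0 a1 a2 := exists k : R -> R,
  [/\ {for 0, continuous k}, k 0 = a2 &
      \forall t \near (0 : R), h t = a0 + a1 * t + k t * t ^+ 2].

Lemma jet0 {h a0 a1 a2} : jet h a0 a1 a2 -> h 0 = a0.
Proof.
by case=> k [_ _ /nbhs_singleton ->]; rewrite mulr0 expr0n /= mulr0 !addr0.
Qed.

Lemma jet_near {h h' a0 a1 a2} : (\forall t \near (0 : R), h t = h' t) ->
  jet h a0 a1 a2 -> jet h' a0 a1 a2.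
Proof.
move=> hh' [k [kc k0 hk]]; exists k; split=> //.
by apply: filterS2 hh' hk => t ->.
Qed.

Lemma jet_quad a0 a1 a2 : jet (fun t => a0 + a1 * t + a2 * t ^+ 2) a0 a1 a2.
Proof.
exists (fun=> a2); split; [exact: cst_continuous | by [] | by near=> t].
Unshelve. all: by end_near. Qed.

Lemma jetD {h h' a0 a1 a2 b0 b1 b2} : jet h a0 a1 a2 -> jet h' b0 b1 b2 ->
  jet (fun t => h t + h' t) (a0 + b0) (a1 + b1) (a2 + b2).
Proof.
move=> [k [kc k0 hk]] [l [lc l0 hl]]; exists (fun t => k t + l t).
split; [exact: cvgD | by rewrite k0 l0 | ].
by apply: filterS2 hk hl => t -> ->; ring.
Qed.

Lemma jetM {h h' a0 a1 a2 b0 b1 b2} : jet h a0 a1 a2 -> jet h' b0 b1 b2 ->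
  jet (fun t => h t * h' t) (a0 * b0) (a0 * b1 + a1 * b0)
      (a0 * b2 + a1 * b1 + a2 * b0).
Proof.
move=> [k [kc k0 hk]] [l [lc l0 hl]].
exists (fun t => a0 * l t + a1 * b1 + b0 * k t
                 + t * (a1 * l t + b1 * k t) + t ^+ 2 * (k t * l t)).
have cv a (m : R -> R) : {for 0, continuous m} ->
  {for 0, continuous (fun t => a * m t)}.
  by move=> mc; apply: cvgM => //; exact: cvg_cst.
split; last first.
- by apply: filterS2 hk hl => t -> ->; ring.
- by rewrite k0 l0; ring.
apply: cvgD; last first.
  by apply: cvgM; [exact: exprn_continuous|exact: cvgM].
apply: cvgD.
  by apply: cvgD; [apply: cvgD; [exact: cv|exact: cvg_cst]|exact: cv].
by apply: cvgM; [exact: cvg_id|apply: cvgD; exact: cv].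
Qed.

Lemma jetZ {h a0 a1 a2} c : jet h a0 a1 a2 ->
  jet (fun t => c * h t) (c * a0) (c * a1) (c * a2).
Proof.
move=> [k [kc k0 hk]]; exists (fun t => c * k t).
split; [by apply: cvgM => //; exact: cvg_cst | by rewrite k0 | ].
by apply: filterS hk => t ->; ring.
Qed.

Lemma jetB {h h' a0 a1 a2 b0 b1 b2} : jet h a0 a1 a2 -> jet h' b0 b1 b2 ->
  jet (fun t => h t - h' t) (a0 - b0) (a1 - b1) (a2 - b2).
Proof.
move=> jh /(jetZ (-1)) jh'.
have := jetD jh jh'; rewrite !mulN1r.
apply: jet_near; near=> t; rewrite mulN1r.
Unshelve. all: by end_near. Qed.

Lemma jet_continuous {h a0 a1 a2} : jet h a0 a1 a2 -> {for 0, continuous h}.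
Proof.
move=> jh; have h0 := jet0 jh; case: jh => k [kc k0 hk].
have cq : {for 0, continuous (fun t => a0 + a1 * t + k t * t ^+ 2)}.
  apply: cvgD; last by apply: cvgM => //; exact: exprn_continuous.
  apply: cvgD; first exact: cvg_cst.
  by apply: cvgM; [exact: cvg_cst|exact: cvg_id].
rewrite /prop_for /continuous_at h0.
have -> : a0 = a0 + a1 * 0 + k 0 * 0 ^+ 2 by ring.
apply: cvg_trans cq; apply: near_eq_cvg.
by apply: filterS hk.
Qed.

Lemma jet_comp {P h : R -> R} {a0 a1 a2 p1 p2} :
  jet (fun d => P (a0 + d)) (P a0) p1 p2 -> jet h a0 a1 a2 ->
  jet (fun t => P (h t)) (P a0) (p1 * a1) (p1 * a2 + p2 * a1 ^+ 2).
Proof.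
move=> [l [lc l0 hl]] jh; have h0 := jet0 jh; have hc := jet_continuous jh.
case: jh => k [kc k0 hk].
have dc : (h t - a0) @[t --> (0 : R)] --> (0 : R).
  have : (h t - a0) @[t --> (0 : R)] --> h 0 - a0.
    by apply: cvgB; [exact: hc | exact: cvg_cst].
  by rewrite h0 subrr.
exists (fun t => p1 * k t + l (h t - a0) * (a1 + k t * t) ^+ 2); split.
- apply: cvgD; first by apply: cvgM => //; exact: cvg_cst.
  apply: (@cvgM _ _ _ _ (fun t => l (h t - a0))).
    have -> : h 0 - a0 = 0 by rewrite h0 subrr.
    exact: (cvg_comp _ _ dc).
  apply: (@cvg_comp _ _ _ (fun t => a1 + k t * t) (fun x => x ^+ 2));
    last exact: exprn_continuous.
  apply: cvgD; first exact: cvg_cst.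
  by apply: cvgM => //; exact: cvg_id.
- by rewrite h0 subrr l0 k0; ring.
apply: filterS2 hk (dc _ hl) => t E.
rewrite /= subrKC => ->.
have -> : h t - a0 = a1 * t + k t * t ^+ 2 by rewrite E; ring.
by ring.
Qed.

Lemma jet_max {h a0 a1 a2} : jet h a0 a1 a2 ->
  (\forall t \near (0 : R), h t <= h 0) -> a1 = 0 /\ a2 <= 0.
Proof.
move=> jh; have h0 := jet0 jh; case: jh => k [kc k0 hk] hm.
have tk : (t * k t) @[t --> (0 : R)] --> (0 : R).
  by rewrite -{2}(mul0r (k 0)); apply: cvgM => //; exact: cvg_id.
have key : \forall t \near (0 : R), (a1 + t * k t) * t <= 0.
  apply: filterS2 hm hk => t; rewrite h0 => + E; rewrite E; lra.
have a10 : a1 = 0.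
  apply/eqP/negP => /negP a1n.
  have e0 : 0 < `|a1| / 2 by rewrite divr_gt0// normr_gt0.
  have /cvgrPdist_lt/(_ _ e0) nk := tk.
  have /nbhs_ballP[e /= e1 be] : nbhs (0 : R)
      (fun t => (a1 + t * k t) * t <= 0 /\ `|0 - t * k t| < `|a1| / 2).
    exact: filterI.
  (* A step on the side where a1 t > 0: within radius e the correction [t * k t] stays below |a1|/2,
     so the linear term wins. *)
  pose t := (e / 2) * Num.sg a1.
  have t0 : t * a1 = (e / 2) * `|a1| by rewrite /t -mulrA -normrEsg.
  have tt : `|t| = e / 2.
    by rewrite normrM normr_sg a1n mulr1 gtr0_norm ?divr_gt0.
  have [|A] := be t.
    by rewrite /ball /= sub0r normrN tt ltr_pdivrMr// ltr_pMr// ltr1n.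
  rewrite sub0r normrN => B.
  have := ler_norm (- (t * k t * t)).
  rewrite normrN [`|t * k t * t|]normrM tt.
  have : `|t * k t| * (e / 2) < `|a1| / 2 * (e / 2) by rewrite ltr_pM2r// divr_gt0.
  have : 0 < e / 2 * `|a1| by rewrite mulr_gt0 ?normr_gt0 ?divr_gt0.
  by move: A; rewrite mulrDl [a1 * t]mulrC t0; lra.
split=> //; rewrite leNgt; apply/negP => a20.
have /cvgr_gt/(_ 0) : k t @[t --> (0 : R)] --> a2 by rewrite -k0.
move=> /(_ a20) kp.
have /nbhs_ballP[e /= e1 be] : nbhs (0 : R)
    (fun t => (a1 + t * k t) * t <= 0 /\ 0 < k t) by exact: filterI.
have [|] := be (e / 2).
  rewrite /ball /= sub0r normrN gtr0_norm ?divr_gt0//.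
  by rewrite ltr_pdivrMr// ltr_pMr// ltr1n.
rewrite a10 add0r => A B.
have e2 : 0 < e / 2 by rewrite divr_gt0.
by have := mulr_gt0 (mulr_gt0 e2 B) e2; lra.
Qed.

(** Signed form: t may be negative or 0, as an increment around a point requires. *)
Lemma MVT_from0 (f df : R -> R) (t : R) :
  (forall y : R, `|y| <= `|t| -> is_derive y 1 f (df y)) ->
  exists2 c, `|c| <= `|t| & f t - f 0 = df c * t.
Proof.
move=> fd.
have fc (a b : R) : `|a| <= `|t| -> `|b| <= `|t| -> {within `[a, b], continuous f}.
  move=> at_ bt; apply: derivable_within_continuous => x.
  rewrite in_itv /= => /andP[ax xb].
  have [] := fd x; last by [].
  by move: at_ bt; rewrite !ler_norml => /andP[? ?] /andP[? ?]; apply/andP; split; lra.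
have [t0|t0|t0] := ltgtP t 0.
- have [||c] := @MVT R f df t 0 t0; last 1 first.
  + rewrite in_itv /= => /andP[tc c0] E; exists c; last by lra.
    by rewrite (ltr0_norm t0) (ltr0_norm c0) lerN2 ltW.
  + move=> x; rewrite in_itv /= => /andP[tc c0]; apply: fd.
    by rewrite (ltr0_norm t0) (ltr0_norm c0) lerN2 ltW.
  + by apply: fc; rewrite // normr0.
- have [||c] := @MVT R f df 0 t t0; last 1 first.
  + rewrite in_itv /= => /andP[c0 ct] E; exists c; last by lra.
    by rewrite (gtr0_norm t0) (gtr0_norm c0) ltW.
  + move=> x; rewrite in_itv /= => /andP[c0 ct]; apply: fd.
    by rewrite (gtr0_norm t0) (gtr0_norm c0) ltW.
  + by apply: fc; rewrite // normr0.
- by exists 0; rewrite t0 ?normr0// subrr mulr0.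
Qed.

(** Admitting t = 0 replaces the punctured filter of the difference quotient by [nbhs 0], which
    makes shifts and intersections of neighbourhoods immediate. *)
Lemma is_derive_littleo (h : R -> R) (x d : R) : is_derive x 1 h d <->
  forall e, 0 < e ->
    \forall t \near (0 : R), `|h (x + t) - h x - d * t| <= e * `|t|.
Proof.
pose q := fun t : R => t^-1 *: ((h \o shift x) (t *: (1 : R)) - h x).
have qE (t e : R) : t != 0 ->
    (`|d - q t| <= e) = (`|h (x + t) - h x - d * t| <= e * `|t|).
  move=> t0; rewrite /q /= [t *: _]mulr1 [t + x]addrC distrC.
  rewrite -[RHS](@ler_pM2l _ `|t|^-1) ?invr_gt0 ?normr_gt0//.
  rewrite mulrCA mulVf ?normr_eq0// mulr1 -normfV -normrM mulrBr.
  by rewrite [_ * (d * t)]mulrC mulfK.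
split=> [[hd hE] e e0|H].
  have /cvgrPdist_le/(_ _ e0) : q @ 0^' --> d by rewrite -hE.
  rewrite near_withinE; apply: filterS => t H.
  have [->|t0] := eqVneq t 0; first by rewrite addr0 mulr0 !subrr normr0 mulr0.
  by rewrite -qE// H.
have qd : q @ 0^' --> d.
  apply/cvgrPdist_le => e e0; rewrite near_withinE.
  by apply: filterS (H e e0) => t ? t0; rewrite qE.
apply: DeriveDef; [exact: cvgP qd | exact: cvg_lim qd].
Qed.

(** Peano form: [h1] is differentiable at the single point 0 only. The mean value theorem is applied
    to [h] minus its quadratic polynomial, whose derivative h1 y - h1 0 - h2 y is o(y). *)
Lemma jet_taylor (h h1 : R -> R) (h2 : R) :
  (\forall t \near (0 : R), is_derive (t : R) 1 h (h1 t)) -> is_derive (0 : R) 1 h1 h2 ->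
  jet h (h 0) (h1 0) (h2 / 2).
Proof.
move=> hd h1d.
pose k t := if t == 0 then h2 / 2 else (h t - h 0 - h1 0 * t) / t ^+ 2.
exists k; split; rewrite /k ?eqxx//; last first.
  near=> t; case: eqP => [->|/eqP t0]; first by ring.
  by field.
rewrite /prop_for /continuous_at eqxx; apply/cvgrPdist_le => e e0.
have hq := (is_derive_littleo _ _ _).1 h1d e e0.
have /nbhs_ballP[r /= r0 br] : nbhs (0 : R) (fun t => is_derive (t : R) 1 h (h1 t) /\
    `|h1 (0 + t) - h1 0 - h2 * t| <= e * `|t|) by exact: filterI.
apply/nbhs_ballP; exists r => //= t; rewrite /ball /= sub0r normrN => tr.
case: eqP => [_|/eqP t0]; first by rewrite subrr normr0 ltW.
pose f y := h y - h1 0 * y - h2 / 2 * y ^+ 2.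
have [y yt|c ct] := @MVT_from0 f (fun y => h1 y - h1 0 - h2 * y) t.
  have [|hy _] := br y.
    by rewrite /ball /= sub0r normrN (le_lt_trans yt).
  rewrite /f; apply: is_derive_eq; rewrite /GRing.scale /=. by field.
have [|_] := br c.
  by rewrite /ball /= sub0r normrN (le_lt_trans ct).
rewrite add0r => hc E.
have -> : h2 / 2 - (h t - h 0 - h1 0 * t) / t ^+ 2 = - ((f t - f 0) / t ^+ 2).
  by rewrite /f; field.
rewrite normrN normrM normfV E normrM normrX ler_pdivrMr ?exprn_gt0 ?normr_gt0//.
rewrite expr2 mulrA ler_pM2r ?normr_gt0//.
by apply: le_trans hc _; rewrite ler_pM2l.
Unshelve. all: by end_near. Qed.

End Jets.

(** * Partial derivatives, derivatives along rays, and symmetry of the Hessian *)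

Section PlaneCalculus.
Context {R : realType}.
Local Notation plane := (R * R)%type.
Implicit Types (Om : set plane) (u : plane -> R) (p q w : plane).

Definition ray p w (t : R) : plane := (p.1 + t * w.1, p.2 + t * w.2).

Lemma ray0 p w : ray p w 0 = p.
Proof. by rewrite /ray !mul0r !addr0 -surjective_pairing. Qed.

Lemma rayD p w s t : ray (ray p w s) w t = ray p w (s + t).
Proof. by rewrite /ray /= !mulrDl !addrA. Qed.

Lemma is_derive_shift (h : R -> R) (x y d : R) :
  is_derive (x + y) 1 h d <-> is_derive y 1 (fun z => h (x + z)) d.
Proof.
by split=> /is_derive_littleo H; apply/is_derive_littleo => e e0;
   apply: filterS (H e e0) => t; rewrite addrA.
Qed.

Lemma is_derive_lincomb (f g : R -> R) (a b x df dg : R) :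
  is_derive x 1 f df -> is_derive x 1 g dg ->
  is_derive x 1 (fun t => a * f t + b * g t) (a * df + b * dg).
Proof. by move=> fd gd; apply: is_derive_eq. Qed.

Lemma is_derive_dx u p : derivable u p ((1, 0) : plane) ->
  is_derive p.1 1 (fun y => u (y, p.2)) (dx u p).
Proof.
have E : (fun h : R => h^-1 *: ((u \o shift p) (h *: ((1, 0) : plane)) - u p)) =
    (fun h : R => h^-1 *: (((fun y => u (y, p.2)) \o shift p.1) (h *: (1 : R))
                           - u (p.1, p.2))).
  apply/funext => h /=; congr (_ *: (u _ - u _)); last by case: p.
  by apply/pair_equal_spec; split; rewrite //= /GRing.scale /= mulr0 add0r.
by move=> du; apply: DeriveDef; rewrite /dx /derivable /derive -?E.
Qed.

Lemma is_derive_dt u p : derivable u p ((0, 1) : plane) ->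
  is_derive p.2 1 (fun y => u (p.1, y)) (dt u p).
Proof.
have E : (fun h : R => h^-1 *: ((u \o shift p) (h *: ((0, 1) : plane)) - u p)) =
    (fun h : R => h^-1 *: (((fun y => u (p.1, y)) \o shift p.2) (h *: (1 : R))
                           - u (p.1, p.2))).
  apply/funext => h /=; congr (_ *: (u _ - u _)); last by case: p.
  by apply/pair_equal_spec; split; rewrite //= /GRing.scale /= mulr0 add0r.
by move=> du; apply: DeriveDef; rewrite /dt /derivable /derive -?E.
Qed.

(* Otherwise unification compares dx u with dt u by unfolding limits. *)
#[local] Opaque dx dt.

Lemma is_derive_dx_shift u (a b y : R) : derivable u (a + y, b) ((1, 0) : plane) ->
  is_derive y 1 (fun y => u (a + y, b)) (dx u (a + y, b)).
Proof.
by move=> /is_derive_dx /= H; apply: (is_derive_shift (fun z => u (z, b)) a y _).1.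
Qed.

Lemma is_derive_dt_shift u (a b y : R) : derivable u (a, b + y) ((0, 1) : plane) ->
  is_derive y 1 (fun y => u (a, b + y)) (dt u (a, b + y)).
Proof.
by move=> /is_derive_dt /= H; apply: (is_derive_shift (fun z => u (a, z)) b y _).1.
Qed.

Definition C1 Om u :=
  has_partials Om u /\
  forall p, Om p -> {for p, continuous (dx u)} /\ {for p, continuous (dt u)}.

Definition C2 Om u := [/\ C1 Om u, C1 Om (dx u) & C1 Om (dt u)].

Lemma ball_box p r (q : plane) :
  ball p r q <-> `|p.1 - q.1| < r /\ `|p.2 - q.2| < r.
Proof. by []. Qed.

(** Continuous partials yield directional derivatives: the increment is split into a horizontal and
    a vertical leg, and the mean value theorem on each leg produces a partial at a point close to
    [p]. *)
Lemma is_derive_ray0 Om u p w : open Om -> C1 Om u -> Om p ->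
  is_derive (0 : R) 1 (fun t => u (ray p w t)) (w.1 * dx u p + w.2 * dt u p).
Proof.
move=> oOm [pu cu] Omp; apply/is_derive_littleo => e e0.
have [cx ct] := cu p Omp.
pose W := `|w.1| + `|w.2| + 1.
have W0 : 0 < W by rewrite ltr_wpDl ?addr_ge0.
have eW : 0 < e / W by rewrite divr_gt0.
have /nbhs_ballP[r /= r0 br] : nbhs p (fun q => [/\ Om q,
    `|dx u p - dx u q| <= e / W & `|dt u p - dt u q| <= e / W]).
  have nO : nbhs p Om by exact: open_nbhs_nbhs.
  move/cvgrPdist_le/(_ _ eW) : cx => cx; move/cvgrPdist_le/(_ _ eW) : ct => ct.
  by apply: filterS3 nO cx ct => q h1 h2 h3; exact: And3 h1 h2 h3.
apply/nbhs_ballP; exists (r / W); first by rewrite /= divr_gt0.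
move=> t; rewrite /ball /= sub0r normrN ltr_pdivlMr// => tW.
have lt1 : `|t * w.1| < r.
  rewrite normrM; apply: le_lt_trans tW; rewrite ler_wpM2l// /W.
  by rewrite -addrA lerDl addr_ge0.
have lt2 : `|t * w.2| < r.
  rewrite normrM; apply: le_lt_trans tW; rewrite ler_wpM2l// /W.
  by rewrite addrAC lerDr addr_ge0.
have [|c1 c1t E1] := @MVT_from0 R (fun y => u (p.1 + y, p.2))
    (fun y => dx u (p.1 + y, p.2)) (t * w.1).
  move=> y yt.
  have [|? _ _] := br (p.1 + y, p.2).
    rewrite ball_box /= subrr normr0 opprD addrA subrr sub0r normrN; split=> //.
    exact: le_lt_trans lt1.
  exact: is_derive_dx_shift (pu _ _).1.
have [|c2 c2t E2] := @MVT_from0 R (fun y => u (p.1 + t * w.1, p.2 + y))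
    (fun y => dt u (p.1 + t * w.1, p.2 + y)) (t * w.2).
  move=> y yt.
  have [|? _ _] := br (p.1 + t * w.1, p.2 + y).
    rewrite ball_box /= !opprD !addrA !subrr !sub0r !normrN; split=> //.
    exact: le_lt_trans lt2.
  exact: is_derive_dt_shift (pu _ _).2.
have [|_ e1 _] := br (p.1 + c1, p.2).
  rewrite ball_box /= subrr normr0 opprD addrA subrr sub0r normrN; split=> //.
  exact: le_lt_trans lt1.
have [|_ _ e2] := br (p.1 + t * w.1, p.2 + c2).
  rewrite ball_box /= !opprD !addrA !subrr !sub0r !normrN; split=> //.
  exact: le_lt_trans lt2.
rewrite add0r ray0.
have -> : u (ray p w t) - u p - (w.1 * dx u p + w.2 * dt u p) * t =
    - (t * (w.1 * (dx u p - dx u (p.1 + c1, p.2))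
        + w.2 * (dt u p - dt u (p.1 + t * w.1, p.2 + c2)))).
  have -> : u (ray p w t) - u p =
    (u (p.1 + t * w.1, p.2 + t * w.2) - u (p.1 + t * w.1, p.2 + 0))
    + (u (p.1 + t * w.1, p.2) - u (p.1 + 0, p.2)).
    by rewrite !addr0 subrKA -surjective_pairing.
  by rewrite E1 E2; ring.
rewrite normrN normrM mulrC ler_wpM2r//.
apply: (le_trans (ler_normD _ _)); rewrite !normrM.
have -> : e = (W * (e / W)) by rewrite mulrC divfK// gt_eqF.
apply: (@le_trans _ _ (`|w.1| * (e / W) + `|w.2| * (e / W))).
  by apply: lerD; rewrite ler_wpM2l.
by rewrite -mulrDl ler_wpM2r ?(ltW eW)// /W lerDl.
Qed.

Lemma is_derive_ray Om u p w t : open Om -> C1 Om u -> Om (ray p w t) ->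
  is_derive t 1 (fun t => u (ray p w t))
    (w.1 * dx u (ray p w t) + w.2 * dt u (ray p w t)).
Proof.
move=> oOm cu Ot; rewrite -(addr0 t).
apply: (is_derive_shift (fun t => u (ray p w t)) t 0 _).2; rewrite addr0.
have -> : (fun z => u (ray p w (t + z))) = (fun z => u (ray (ray p w t) w z)).
  by apply/funext => z; rewrite rayD.
exact: (@is_derive_ray0 Om).
Qed.

(** The mean value theorem in one variable, then in the other. The four-corner difference does not
    depend on the order, so either mixed derivative can be read off it. *)
Lemma double_difference (U Ua Uab : R -> R -> R) (s : R) :
  (forall a b : R, `|a| <= `|s| -> `|b| <= `|s| ->
     is_derive a 1 (fun a => U a b) (Ua a b)) ->
  (forall a b : R, `|a| <= `|s| -> `|b| <= `|s| ->
     is_derive b 1 (Ua a) (Uab a b)) ->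
  exists a b, [/\ `|a| <= `|s|, `|b| <= `|s| &
    U s s - U s 0 - U 0 s + U 0 0 = s ^+ 2 * Uab a b].
Proof.
move=> Ha Hb.
have [|a as_ E] := @MVT_from0 R (fun a => U a s - U a 0) (fun a => Ua a s - Ua a 0) s.
  move=> a as_; have H1 := Ha a s as_ (lexx _); have H2 := Ha a 0 as_.
  by apply: is_deriveB => //; apply: H2; rewrite normr0.
have [|b bs E'] := @MVT_from0 R (Ua a) (Uab a) s.
  by move=> b bs; exact: Hb.
by exists a, b; split=> //; rewrite expr2 mulrAC -mulrA -[X in _ * X]E' mulrC -E; ring.
Qed.

Lemma near_ray Om p w : open Om -> Om p -> \forall t \near (0 : R), Om (ray p w t).
Proof.
move=> oOm Omp; have /nbhs_ballP[r /= r0 br] : nbhs p Om by exact: open_nbhs_nbhs.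
pose W := `|w.1| + `|w.2| + 1.
have W0 : 0 < W by rewrite ltr_wpDl ?addr_ge0.
apply/nbhs_ballP; exists (r / W); first by rewrite /= divr_gt0.
move=> t; rewrite /ball /= sub0r normrN ltr_pdivlMr// => tW; apply: br.
rewrite ball_box /= !opprD !addrA !subrr !sub0r !normrN !normrM.
split; apply: le_lt_trans tW; rewrite ler_wpM2l// /W.
  by rewrite -addrA lerDl addr_ge0.
by rewrite addrAC lerDr addr_ge0.
Qed.

(** The expansion along a ray meets both mixed derivatives, while the equation contains only
    [dt (dx u)]. Both are values of one second difference over s^2 at points near [p]; continuity of
    each closes the gap. *)
Lemma schwarz {Om u p} : open Om -> C2 Om u -> Om p -> dt (dx u) p = dx (dt u) p.
Proof.
move=> oOm [[pu _] [px cx] [pt ct]] Omp; apply/eqP; rewrite -subr_eq0 -normr_eq0.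
rewrite eq_le normr_ge0 andbT; apply/ler_addgt0Pr => e e0; rewrite add0r.
have e2 : 0 < e / 2 by rewrite divr_gt0.
have /nbhs_ballP[r /= r0 br] : nbhs p (fun q => [/\ Om q,
    `|dt (dx u) p - dt (dx u) q| <= e / 2 & `|dx (dt u) p - dx (dt u) q| <= e / 2]).
  have nO : nbhs p Om by exact: open_nbhs_nbhs.
  move/cvgrPdist_le/(_ _ e2) : (cx p Omp).2 => c1.
  move/cvgrPdist_le/(_ _ e2) : (ct p Omp).1 => c2.
  by apply: filterS3 nO c1 c2 => q h1 h2 h3; exact: And3 h1 h2 h3.
pose s := r / 2.
have s0 : 0 < s by rewrite divr_gt0.
have box (a b : R) : `|a| <= `|s| -> `|b| <= `|s| -> ball p r (p.1 + a, p.2 + b).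
  move=> a1 b1; rewrite ball_box /= !opprD !addrA !subrr !sub0r !normrN.
  by split; [apply: le_lt_trans a1 _|apply: le_lt_trans b1 _];
    rewrite gtr0_norm// /s ltr_pdivrMr// ltr_pMr// ltr1n.
have Obox (a b : R) : `|a| <= `|s| -> `|b| <= `|s| -> Om (p.1 + a, p.2 + b).
  by move=> a1 b1; have [] := br _ (box _ _ a1 b1).
have [||a [b [a1 b1 E]]] := @double_difference
    (fun a b => u (p.1 + a, p.2 + b)) (fun a b => dx u (p.1 + a, p.2 + b))
    (fun a b => dt (dx u) (p.1 + a, p.2 + b)) s.
- move=> a b /Obox H /H Oab.
  exact: is_derive_dx_shift (pu _ _).1.
- move=> a b /Obox H /H Oab.
  exact: is_derive_dt_shift (px _ _).2.
have [||b' [a' [b1' a1' E']]] := @double_difference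
    (fun b a => u (p.1 + a, p.2 + b)) (fun b a => dt u (p.1 + a, p.2 + b))
    (fun b a => dx (dt u) (p.1 + a, p.2 + b)) s.
- move=> b' a' b1' a1'.
  exact: is_derive_dt_shift (pu _ (Obox _ _ a1' b1')).2.
- move=> b' a' b1' a1'.
  exact: is_derive_dx_shift (pt _ (Obox _ _ a1' b1')).1.
have [_ H1 _] := br _ (box _ _ a1 b1); have [_ _ H2] := br _ (box _ _ a1' b1').
have EE : dt (dx u) (p.1 + a, p.2 + b) = dx (dt u) (p.1 + a', p.2 + b').
  apply: (@mulfI _ (s ^+ 2)); first by rewrite expf_neq0// gt_eqF.
  by apply: (etrans (esym E)); apply: (etrans _ E'); congr (_ + _); rewrite addrAC.
move: EE H1 H2.
move: (dt (dx u) p) (dx (dt u) p) (dt (dx u) _) (dx (dt u) _) => A B A' B' ->.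
by rewrite !ler_norml => /andP[? ?] /andP[? ?]; apply/andP; split; lra.
Qed.

Lemma jet_ray Om u p w : open Om -> C2 Om u -> Om p ->
  jet (fun t => u (ray p w t)) (u p) (w.1 * dx u p + w.2 * dt u p)
    ((w.1 ^+ 2 * dx (dx u) p + 2 * w.1 * w.2 * dt (dx u) p
      + w.2 ^+ 2 * dt (dt u) p) / 2).
Proof.
move=> oOm cu Omp; have [cu0 cux cut] := cu.
have H : is_derive (0 : R) 1 (fun t => w.1 * dx u (ray p w t) + w.2 * dt u (ray p w t))
    (w.1 ^+ 2 * dx (dx u) p + 2 * w.1 * w.2 * dt (dx u) p
      + w.2 ^+ 2 * dt (dt u) p).
  have Hx := @is_derive_ray0 Om (dx u) p w oOm cux Omp.
  have Ht := @is_derive_ray0 Om (dt u) p w oOm cut Omp.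
  have S := schwarz oOm cu Omp.
  have L := @is_derive_lincomb _ _ w.1 w.2 0 _ _ Hx Ht.
  move: L.
  rewrite -S.
  move: (dx (dx u) p) (dt (dx u) p) (dt (dt u) p) => A B C.
  by congr (is_derive _ _ _ _); ring.
have N : \forall t \near (0 : R), is_derive (t : R) 1 (fun t => u (ray p w t))
    (w.1 * dx u (ray p w t) + w.2 * dt u (ray p w t)).
  move: (near_ray _ p w oOm Omp); apply: filterS => t; exact: is_derive_ray.
by have := jet_taylor _ _ _ N H; rewrite !ray0.
Qed.

End PlaneCalculus.

(** * Continuity on a subset and extrema over compact sets *)

Section WithinContinuity.
Context {R : realType} {T U : topologicalType}.
Implicit Types (A : set T) (B : set U) (F G : T -> R).

Lemma within_continuous_comp A F (P : R -> R) : continuous P ->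
  {within A, continuous F} -> {within A, continuous (fun p => P (F p))}.
Proof.
by move=> cP cF x; apply: (@continuous_comp (subspace A) _ _ F P); [exact: cF|exact: cP].
Qed.

Lemma within_continuousD A F G : {within A, continuous F} ->
  {within A, continuous G} -> {within A, continuous (fun p => F p + G p)}.
Proof. by move=> cF cG x; apply: continuousD; [exact: cF|exact: cG]. Qed.

Lemma within_continuousM A F G : {within A, continuous F} ->
  {within A, continuous G} -> {within A, continuous (fun p => F p * G p)}.
Proof. by move=> cF cG x; apply: continuousM; [exact: cF|exact: cG]. Qed.

Lemma within_continuousB A F G : {within A, continuous F} ->
  {within A, continuous G} -> {within A, continuous (fun p => F p - G p)}.
Proof. by move=> cF cG x; apply: continuousB; [exact: cF|exact: cG]. Qed.

Lemma within_continuous_fst A B F : {within A, continuous F} ->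
  {within A `*` B, continuous (fun z : T * U => F z.1)}.
Proof.
move=> /subspace_continuousP cF; apply/subspace_continuousP => -[x y] [/= Ax By].
apply: cvg_trans (cF x Ax) => W /= FW.
have : nbhs x (fun p => A p -> W (F p)) by exact: FW.
move=> Wx; rewrite /within /= /nbhs/=.
exists ((fun p => A p -> W (F p)), setT) => /=; first by split=> //; exact: filterT.
by move=> [p q] /= [H _] [/= Ap _]; exact: H.
Qed.

Lemma within_continuous_snd A B (G : U -> R) : {within B, continuous G} ->
  {within A `*` B, continuous (fun z : T * U => G z.2)}.
Proof.
move=> /subspace_continuousP cF; apply/subspace_continuousP => -[x y] [/= Ax By].
apply: cvg_trans (cF y By) => W /= FW.
have : nbhs y (fun p => B p -> W (G p)) by exact: FW.
move=> Wx; rewrite /within /= /nbhs/=.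
exists (setT, (fun p => B p -> W (G p))) => /=; first by split=> //; exact: filterT.
by move=> [p q] /= [_ H] [/= _ Bq]; exact: H.
Qed.

Lemma closure_ge0 A F : {within closure A, continuous F} ->
  (forall p, A p -> 0 <= F p) -> forall p, closure A p -> 0 <= F p.
Proof.
move=> /subspace_continuousP cF F0 p cp; rewrite leNgt; apply/negP => Fp.
have := cF p cp => /cvgr_lt/(_ 0 Fp); rewrite near_withinE => /cp[q [Aq H]].
by have := F0 q Aq; rewrite leNgt H//; exact: subset_closure.
Qed.

Lemma max_onP A F p : compact A -> {within A, continuous F} -> A p ->
  F p <= max_on A F.
Proof.
move=> cA cF Ap; apply: ub_le_sup; last by exists p.
have [|c _ H] := compact_EVT_max _ cA cF; first by exists p.
by exists (F c) => _ [q Aq <-]; apply: H; rewrite inE.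
Qed.

Lemma min_onP A F p : compact A -> {within A, continuous F} -> A p ->
  min_on A F <= F p.
Proof.
move=> cA cF Ap; apply: ge_inf; last by exists p.
have [|c _ H] := compact_EVT_min _ cA cF; first by exists p.
by exists (F c) => _ [q Aq <-]; apply: H; rewrite inE.
Qed.

Lemma min_on_gt0 A F : A !=set0 -> compact A -> {within A, continuous F} ->
  (forall p, A p -> 0 < F p) -> 0 < min_on A F.
Proof.
move=> A0 cA cF F0; have [c] := compact_EVT_min A0 cA cF.
rewrite inE => Ac H; apply: (lt_le_trans (F0 c Ac)).
apply: lb_le_inf; first exact: image_nonempty.
by move=> _ [q Aq <-]; apply: H; rewrite inE.
Qed.

End WithinContinuity.

(** * Boundary points on segments, convexity, and extension to the closure *)

Section PlaneDomains.
Context {R : realType}.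
Local Notation plane := (R * R)%type.
Implicit Types (Om : set plane) (u : plane -> R) (p q w : plane).
#[local] Opaque dx dt.

Lemma bounded_compact_closure Om : bounded_set Om -> compact (closure Om).
Proof.
case/pinfty_ex_gt0 => M M0 bM.
have cK : compact ((`[- M, M] : set R) `*` (`[- M, M] : set R)).
  by apply: compact_setX; exact: segment_compact.
apply: (subclosed_compact _ cK); first exact: closed_closure.
have clK : closed ((`[- M, M] : set R) `*` (`[- M, M] : set R)).
  by apply: compact_closed cK; exact: (@norm_hausdorff _ plane).
rewrite [X in _ `<=` X](closure_id _).1//; apply: closureS => p Op; move: (bM _ Op).
rewrite /= prod_normE ge_max => /andP[p1 p2].
by split; rewrite /= in_itv /= -ler_norml.
Qed.

Lemma ray_continuous p w : continuous (ray p w).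
Proof.
have lin (a b t : R) : (a + s * b) @[s --> t] --> a + t * b.
  by apply: cvgD; [exact: cvg_cst|apply: cvgM; [exact: cvg_id|exact: cvg_cst]].
by move=> t; exact: (cvg_pair (lin p.1 w.1 t) (lin p.2 w.2 t)).
Qed.

(** Without a boundary point on the segment, the parameters landing in [Om] and those landing in its
    closure coincide. They form an open and closed subset of [0, 1], which is connected. *)
Lemma ray_exit Om p w : open Om -> Om p -> ~ Om (ray p w 1) ->
  exists t, [/\ 0 <= t, t <= 1 & bdry Om (ray p w t)].
Proof.
move=> oOm Omp nOm; apply: contrapT => nb.
have H t : 0 <= t <= 1 -> closure Om (ray p w t) -> Om (ray p w t).
  move=> /andP[t0 t1] ct; apply: contrapT => nt; apply: nb; exists t; split=> //.
  by split=> //; rewrite ((interior_id _).1 oOm).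
apply: nOm; have : (`[0, 1] `&` (ray p w @^-1` Om)) = `[0, 1]%classic.
  apply: (@segment_connected R 0 1).
  - by exists 0; split; rewrite /= ?ray0// in_itv /= lexx ler01.
  - exists (ray p w @^-1` Om) => //.
    by apply: open_comp => // t _; exact: ray_continuous.
  - exists (ray p w @^-1` closure Om).
      by apply: preimage_closed => [t _|]; [exact: ray_continuous|exact: closed_closure].
    apply/seteqP; split=> t [/= t01]; first by split=> //; exact: subset_closure.
    by split=> //; apply: H => //; move: t01; rewrite in_itv.
move=> /seteqP[_ /(_ 1)[]//]; by rewrite /= in_itv /= lexx ler01.
Qed.

(** Convexity is given by supporting lines, and segments are recovered from it. An exit point would
    be a convex combination of p and q, yet the line through it leaves both strictly on one side. *)
Lemma convex_ray Om p q t : open Om -> convex_domain Om -> Om p -> Om q ->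
  0 <= t <= 1 -> Om (ray p (q - p) t).
Proof.
move=> oOm cOm Omp Omq /andP[t0 t1]; apply: contrapT => nt.
have [|s [s0 s1 b]] := @ray_exit Om p (t * (q - p).1, t * (q - p).2) oOm Omp.
  by rewrite /ray /= !mul1r.
have [a [b' [c [_ E /[dup] Hp Hq]]]] := cOm _ b.
move/(_ _ Omp) : Hp => Hp; move/(_ _ Omq) : Hq => Hq; move: E; rewrite /ray /= => E.
have [l0 l1] : 0 <= s * t /\ s * t <= 1.
  by split; [rewrite mulr_ge0|rewrite mulr_ile1].
have : (1 - s * t) * (c - (a * p.1 + b' * p.2)) + s * t * (c - (a * q.1 + b' * q.2)) = 0.
  by rewrite -E; ring.
have := mulr_ge0 l0 (ltW (eqbRL (subr_gt0 _ _) Hq)).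
have [/eqP|l2] := eqVneq (s * t) 1; first by move=> /eqP ->; lra.
have : 0 < (1 - s * t) * (c - (a * p.1 + b' * p.2)).
  by rewrite mulr_gt0 ?subr_gt0// lt_neqAle l2.
lra.
Qed.

Lemma ext_closure Om h (h' : plane -> R) p : {within closure Om, continuous h'} ->
  (forall q, Om q -> h' q = h q) -> closure Om p -> ext Om h p = h' p.
Proof.
move=> /subspace_continuousP ch' hh' cp; apply: cvg_lim => //.
have := ch' p cp => H.
have PF : ProperFilter (within Om (nbhs p)) by exact: within_nbhs_proper.
have : h' q @[q --> within Om (nbhs p)] --> h' p.
  apply: cvg_trans H; apply: cvg_app; apply: within_subset; exact: subset_closure.
apply: cvg_trans; apply: near_eq_cvg; rewrite near_withinE.
by near=> q => Oq; rewrite hh'.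
Unshelve. all: by end_near. Qed.

Lemma extends_continuous Om h p : open Om -> extends_continuously Om h -> Om p ->
  {for p, continuous h}.
Proof.
move=> oOm [h' /subspace_continuousP ch' hh'] Omp.
have nO : nbhs p Om by exact: open_nbhs_nbhs.
have H := ch' p (subset_closure Omp).
rewrite /prop_for /continuous_at -(hh' p Omp).
have {}H : h' q @[q --> p] --> h' p.
  apply: cvg_trans H; apply: cvg_app => W /= pW.
  by near=> q; have : closure Om q by [apply: subset_closure; near: q]; near: q.
apply: cvg_trans H; apply: near_eq_cvg.
by apply: filterS nO => q /hh'.
Unshelve. all: by end_near. Qed.

Lemma C2alpha_closureC2 alpha Om u : open Om -> C2alpha_closure alpha Om u ->
  C2 Om u.
Proof.
move=> oOm [_ p1 p2 p3 [e1 e2] [f1 f2 f3 f4] _].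
pose c h e p := @extends_continuous Om h p oOm e.
exact: And3 (conj p1 (fun p O => conj (c _ e1 p O) (c _ e2 p O)))
  (conj p2 (fun p O => conj (c _ f1 p O) (c _ f2 p O)))
  (conj p3 (fun p O => conj (c _ f3 p O) (c _ f4 p O))).
Qed.

Lemma near_ray_max Om F p w : open Om -> Om p -> (forall q, Om q -> F q <= F p) ->
  \forall t \near (0 : R), (F (ray p w t) : R) <= F (ray p w 0).
Proof.
move=> oOm Omp H; rewrite ray0; move: (near_ray Om p w oOm Omp).
by apply: filterS => t /H.
Qed.

End PlaneDomains.

(** * Gradient and Hessian along rays, and the conditions at an interior maximum *)

Section SecondOrderExpansions.
Context {R : realType}.
Local Notation plane := (R * R)%type.
Implicit Types (Om : set plane) (u F G : plane -> R) (p q w : plane).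
#[local] Opaque dx dt.

(* (A, B) is the gradient of F at p and X, Y, Z are the entries of its Hessian,
   tested along rays only. *)
Definition jets F p (A B X Y Z : R) := forall w,
  jet (fun t => F (ray p w t)) (F p) (w.1 * A + w.2 * B)
    ((w.1 ^+ 2 * X + 2 * w.1 * w.2 * Y + w.2 ^+ 2 * Z) / 2).

Lemma jets_C2 {Om u p} : open Om -> C2 Om u -> Om p ->
  jets u p (dx u p) (dt u p) (dx (dx u) p) (dt (dx u) p) (dt (dt u) p).
Proof. by move=> oOm cu Op w; exact: (jet_ray Om u p w oOm cu Op). Qed.

Lemma jets_affine p (a b c : R) :
  jets (fun q => a * q.1 + b * q.2 + c) p a b 0 0 0.
Proof.
move=> w; have -> : (w.1 ^+ 2 * 0 + 2 * w.1 * w.2 * 0 + w.2 ^+ 2 * 0) / 2 = 0 :> R.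
  by field.
apply: jet_near (jet_quad _ _ _); near=> t; rewrite /ray /=; ring.
Unshelve. all: by end_near. Qed.

Lemma jetsD {F G p A B X Y Z A' B' X' Y' Z'} :
  jets F p A B X Y Z -> jets G p A' B' X' Y' Z' ->
  jets (fun q => F q + G q) p (A + A') (B + B') (X + X') (Y + Y') (Z + Z').
Proof.
move=> jF jG w; have := jetD (jF w) (jG w).
by congr jet; field.
Qed.

Lemma jetsZ {F p A B X Y Z} c : jets F p A B X Y Z ->
  jets (fun q => c * F q) p (c * A) (c * B) (c * X) (c * Y) (c * Z).
Proof. by move=> jF w; have := jetZ c (jF w); congr jet; field. Qed.

Lemma jetsB {F G p A B X Y Z A' B' X' Y' Z'} :
  jets F p A B X Y Z -> jets G p A' B' X' Y' Z' ->
  jets (fun q => F q - G q) p (A - A') (B - B') (X - X') (Y - Y') (Z - Z').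
Proof.
move=> jF jG w; have := jetB (jF w) (jG w).
by congr jet; field.
Qed.

Lemma jetsM {F G p A B X Y Z A' B' X' Y' Z'} :
  jets F p A B X Y Z -> jets G p A' B' X' Y' Z' ->
  jets (fun q => F q * G q) p (F p * A' + A * G p) (F p * B' + B * G p)
    (F p * X' + 2 * A * A' + X * G p) (F p * Y' + A * B' + B * A' + Y * G p)
    (F p * Z' + 2 * B * B' + Z * G p).
Proof.
move=> jF jG w; have := jetM (jF w) (jG w).
by congr jet; field.
Qed.

Lemma jet_expR (a : R) : jet (fun d => expR (a + d)) (expR a) (expR a) (expR a / 2).
Proof.
have H (x : R) : is_derive x 1 (fun d => expR (a + d)) (expR (a + x)).
  by apply: (is_derive_shift expR a x _).1; exact: is_derive_expR.
have := @jet_taylor R (fun d => expR (a + d)) (fun d => expR (a + d)) (expR (a + 0)) _ (H 0).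
by rewrite addr0; apply; near=> t; exact: H.
Unshelve. all: by end_near. Qed.

Lemma jets_expR {F p A B X Y Z} : jets F p A B X Y Z ->
  jets (fun q => expR (F q)) p (expR (F p) * A) (expR (F p) * B)
    (expR (F p) * (X + A ^+ 2)) (expR (F p) * (Y + A * B))
    (expR (F p) * (Z + B ^+ 2)).
Proof.
move=> jF w; have := jet_comp (jet_expR (F p)) (jF w).
by congr jet; field.
Qed.

Lemma jets_max {Om F p A B X Y Z} : open Om -> Om p ->
  (forall q, Om q -> F q <= F p) -> jets F p A B X Y Z ->
  [/\ A = 0, B = 0 & forall w1 w2 : R, w1 ^+ 2 * X + 2 * w1 * w2 * Y + w2 ^+ 2 * Z <= 0].
Proof.
move=> oOm Op H jF; have M w := jet_max (jF w) (near_ray_max _ _ _ w oOm Op H).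
have [HA _] := M (1, 0); have [HB _] := M (0, 1).
split=> [||w1 w2]; [by move: HA => /=; lra | by move: HB => /=; lra|].
by have [_] := M (w1, w2); rewrite /= pmulr_lle0// invr_gt0.
Qed.

(** a times the matrix (a, b; b, c) is (a, b) (x) (a, b) plus (a c - b^2) e_2 (x) e_2, so two test
    directions suffice. *)
Lemma quadratic_trace_le0 (a b c X Y Z : R) : 0 < a -> b ^+ 2 <= a * c ->
  (forall w1 w2 : R, w1 ^+ 2 * X + 2 * w1 * w2 * Y + w2 ^+ 2 * Z <= 0) ->
  a * X + 2 * b * Y + c * Z <= 0.
Proof.
move=> a0 bac H; rewrite -(@pmulr_rle0 _ a)//.
have Z0 : Z <= 0 by have := H 0 1; lra.
have -> : a * (a * X + 2 * b * Y + c * Z) =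
  (a ^+ 2 * X + 2 * a * b * Y + b ^+ 2 * Z) + (a * c - b ^+ 2) * Z by ring.
have := mulr_ge0_le0 (eqbRL (subr_ge0 _ _) bac) Z0.
by have := H a b; lra.
Qed.

Lemma max_principle {Om F} b : compact (closure Om) -> open Om ->
  {within closure Om, continuous F} ->
  (forall p, Om p -> ~ (forall q, Om q -> F q <= F p)) ->
  (forall p, bdry Om p -> F p <= b) -> forall p, closure Om p -> F p <= b.
Proof.
move=> cO oOm cF H Hb p cp.
have [|c /[1!inE] cc Hc] := compact_EVT_max _ cO cF; first by exists p.
have Hcp : F p <= F c by apply: Hc; rewrite inE.
apply: (le_trans Hcp); apply: Hb; split=> //; rewrite (interior_id _).1// => Oc.
by apply: (H c Oc) => q Oq; apply: Hc; rewrite inE; exact: subset_closure.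
Qed.

End SecondOrderExpansions.

(** * The pointwise inequality behind the boundary barrier *)

Section Barrier.

(** G, P, Q, A, B, C are the value, gradient and Hessian of g; primed letters belong to phi. On (x,
    y) = Du the principal form is (G^2 + eps) x^2 + y^2 + (Q x - P y)^2 >= mu |Du|^2. All other
    terms are at most quadratic in |Dg| <= |Du| + K, hence bounded by a multiple of |Du|^2 once |Du|
    >= 1; [nu] is large enough to beat that multiple. *)
Lemma barrier_algebra (R : realType)
    (G P Q A B C P' Q' A' B' C' eps l K M mu nu sg : R) :
  0 <= eps -> eps <= 1 -> 0 <= l -> l <= 1 -> 0 < G -> G <= M -> 0 <= K ->
  0 < mu -> mu <= 1 -> mu <= G ^+ 2 -> `|sg| = 1 -> 0 < nu ->
  K * (M ^+ 2 + 6 + 4 * K ^+ 2) + M * (3 + 2 * K ^+ 2) < nu * mu ->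
  P' ^+ 2 + Q' ^+ 2 <= K ^+ 2 -> `|A'| <= K -> `|B'| <= K -> `|C'| <= K ->
  A * (G ^+ 2 + Q ^+ 2 + eps) + C * (1 + P ^+ 2) - 2 * P * Q * B
    + l * G * (1 + P ^+ 2) = 0 ->
  1 <= (P - P') ^+ 2 + (Q - Q') ^+ 2 ->
  ~ (G ^+ 2 + Q ^+ 2 + eps) * (sg * (A - A') + nu * (P - P') ^+ 2)
    - 2 * P * Q * (sg * (B - B') + nu * ((P - P') * (Q - Q')))
    + (1 + P ^+ 2) * (sg * (C - C') + nu * (Q - Q') ^+ 2) <= 0.
Proof.
move=> e0 e1 l0 l1 G0 GM K0 mu0 mu1 muG sg1 nu0 Hnu HK HA HB HC E S1 H.
pose S := (P - P') ^+ 2 + (Q - Q') ^+ 2.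
have HS : S = (P - P') ^+ 2 + (Q - Q') ^+ 2 by [].
clearbody S; rewrite -HS in S1.
have x2 := sqr_ge0 (P - P'); have y2 := sqr_ge0 (Q - Q').
(* The operator with coefficients frozen at g, applied to phi; the second derivatives of g itself
   are eliminated by the equation. *)
pose T := (G ^+ 2 + Q ^+ 2 + eps) * A' - 2 * P * Q * B' + (1 + P ^+ 2) * C'.
have HT : T = (G ^+ 2 + Q ^+ 2 + eps) * A' - 2 * P * Q * B' + (1 + P ^+ 2) * C' by [].
clearbody T.
have PQ : P ^+ 2 + Q ^+ 2 <= 2 * K ^+ 2 + 2 * S.
  move: (sqr_ge0 (P - P' - P')) (sqr_ge0 (Q - Q' - Q')) HK HS; clear; lra.
have G2 : G ^+ 2 <= M ^+ 2 by rewrite lerXn2r// nnegrE ltW// (lt_le_trans G0).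
have G20 := sqr_ge0 G; have P20 := sqr_ge0 P; have Q20 := sqr_ge0 Q.
have a1 : 0 <= G ^+ 2 + Q ^+ 2 + eps by rewrite !addr_ge0.
have a2 : 0 <= 1 + P ^+ 2 by rewrite addr_ge0.
have HPQ : `|2 * P * Q| <= P ^+ 2 + Q ^+ 2.
  rewrite ler_norml; move: (sqr_ge0 (P + Q)) (sqr_ge0 (P - Q)); clear => ? ?.
  by apply/andP; split; lra.
have T1 : `|T| <= K * (M ^+ 2 + 2 + 2 * (P ^+ 2 + Q ^+ 2)).
  rewrite HT; apply: (le_trans (ler_normD _ _)).
  apply: (le_trans (lerD (ler_normB _ _) (lexx _))).
  rewrite !(normrM _ A') !(normrM _ B') !(normrM _ C') (ger0_norm a1) (ger0_norm a2).
  have h1 := ler_wpM2l a1 HA; have h3 := ler_wpM2l a2 HC.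
  have h2 : `|2 * P * Q| * `|B'| <= (P ^+ 2 + Q ^+ 2) * K by apply: ler_pM.
  have h4 : K * (G ^+ 2 + eps) <= K * (M ^+ 2 + 1) by apply: ler_wpM2l => //; exact: lerD.
  by move: h1 h2 h3 h4; clear; lra.
have T2 : `|T| <= K * (M ^+ 2 + 6 + 4 * K ^+ 2) * S.
  apply: (le_trans T1).
  have h1 := ler_wpM2l K0 PQ; have K20 := sqr_ge0 K.
  have h2 : K * (M ^+ 2 + 2 + 4 * K ^+ 2) * 1 <= K * (M ^+ 2 + 2 + 4 * K ^+ 2) * S.
    apply: ler_wpM2l => //; apply: mulr_ge0 => //.
    exact: addr_ge0 (addr_ge0 (sqr_ge0 M) (ler0n _ 2)) (mulr_ge0 (ler0n _ 4) K20).
  by move: h1 h2; clear; lra.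
have M0 : 0 <= M by exact: le_trans (ltW G0) GM.
have L1 : l * G * (1 + P ^+ 2) <= M * (3 + 2 * K ^+ 2) * S.
  have lG : l * G <= M.
    by apply: le_trans GM; rewrite -[leRHS]mul1r ler_wpM2r// ltW.
  have h1 := ler_wpM2r a2 lG.
  have h2 : M * (1 + P ^+ 2) <= M * (1 + 2 * K ^+ 2 + 2 * S).
    by apply: ler_wpM2l => //; move: PQ Q20; clear; lra.
  have h3 : M * (1 + 2 * K ^+ 2) * 1 <= M * (1 + 2 * K ^+ 2) * S.
    apply: ler_wpM2l => //; apply: mulr_ge0 => //.
    exact: addr_ge0 ler01 (mulr_ge0 (ler0n _ 2) (sqr_ge0 K)).
  by move: h1 h2 h3; clear; lra.
have L0 : 0 <= l * G * (1 + P ^+ 2) by rewrite mulr_ge0// mulr_ge0// ltW.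
have sT : sg * T <= `|T| by rewrite -[leRHS]mul1r -sg1 -normrM ler_norm.
have sL : sg * (l * G * (1 + P ^+ 2)) <= l * G * (1 + P ^+ 2).
  by apply: le_trans (ler_norm _) _; rewrite normrM sg1 mul1r ger0_norm.
have q : mu * S <= (G ^+ 2 + eps) * (P - P') ^+ 2 + (Q - Q') ^+ 2.
  have h1 : mu * (P - P') ^+ 2 <= (G ^+ 2 + eps) * (P - P') ^+ 2.
    by apply: ler_wpM2r => //; rewrite -[leLHS]addr0; exact: lerD.
  have h2 : mu * (Q - Q') ^+ 2 <= 1 * (Q - Q') ^+ 2 by apply: ler_wpM2r.
  by rewrite HS; move: h1 h2; clear; lra.
have qn := ler_wpM2l (ltW nu0) q.
have q3 : 0 <= nu * (Q * (P - P') - P * (Q - Q')) ^+ 2.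
  by rewrite mulr_ge0 ?sqr_ge0// ltW.
have fin : (K * (M ^+ 2 + 6 + 4 * K ^+ 2) + M * (3 + 2 * K ^+ 2)) * S < nu * mu * S.
  by rewrite ltr_pM2r// (lt_le_trans ltr01).
have Es := congr1 (fun x => sg * x) E; rewrite mulr0 in Es.
have sTE := congr1 (fun x => sg * x) HT.
move: H sTE Es fin q3 qn sL sT L1 T2; clear; lra.
Qed.
End Barrier.

(** * Height bounds and the barrier at the boundary *)

Section MaximumPrincipleEstimates.
Context {R : realType}.
Local Notation plane := (R * R)%type.
Implicit Types (p q w : plane).
#[local] Opaque dx dt.
Variables (Om : set plane) (g : plane -> R) (eps l : R).
Hypotheses (oOm : open Om) (cO : compact (closure Om)).
Hypotheses (cg : {within closure Om, continuous g}) (g2 : C2 Om g).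
Hypotheses (g0 : forall p, Om p -> 0 < g p).
Hypotheses (eps0 : 0 <= eps) (l0 : 0 <= l) (l1 : l <= 1).
Hypothesis geq : hyperbolic_eq eps l Om g.

Lemma continuous_x : {within closure Om, continuous (fun q : plane => q.1)}.
Proof. by apply: continuous_subspaceT => x; exact: cvg_fst. Qed.

Lemma continuous_t : {within closure Om, continuous (fun q : plane => q.2)}.
Proof. by apply: continuous_subspaceT => x; exact: cvg_snd. Qed.

Lemma continuous_affine (a b c : R) :
  {within closure Om, continuous (fun q : plane => a * q.1 + b * q.2 + c)}.
Proof.
apply: within_continuousD; last by move=> x; exact: cvg_cst.
apply: within_continuousD; apply: within_continuousM;
  by [exact: continuous_x|exact: continuous_t|move=> x; exact: cvg_cst].
Qed.

Lemma within_continuousZ (c : R) (F : plane -> R) : {within closure Om, continuous F} ->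
  {within closure Om, continuous (fun q => c * F q : R)}.
Proof. by apply: within_continuousM => x; exact: cvg_cst. Qed.

Lemma principal_coef_gt0 p (Q : R) : Om p -> 0 < g p ^+ 2 + Q ^+ 2 + eps.
Proof.
by move=> /g0 gp; have := exprn_gt0 2 gp; have := sqr_ge0 Q; have := eps0; lra.
Qed.

Lemma principal_part_max {X Y Z : R} {p} : Om p ->
  (forall w1 w2 : R, w1 ^+ 2 * X + 2 * w1 * w2 * Y + w2 ^+ 2 * Z <= 0) ->
  (g p ^+ 2 + dt g p ^+ 2 + eps) * X - 2 * dx g p * dt g p * Y
    + (1 + dx g p ^+ 2) * Z <= 0.
Proof.
move=> Op H; have gp := g0 p Op; move: (dx g p) (dt g p) => P Q.
have a0 := principal_coef_gt0 p Q Op.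
have bac : (- (P * Q)) ^+ 2 <= (g p ^+ 2 + Q ^+ 2 + eps) * (1 + P ^+ 2).
  have H1 := mulr_ge0 (sqr_ge0 (g p)) (sqr_ge0 P).
  have H2 := mulr_ge0 eps0 (sqr_ge0 P).
  by have := sqr_ge0 (g p); have := sqr_ge0 Q; lra.
by have := quadratic_trace_le0 _ _ _ _ _ _ a0 bac H; lra.
Qed.

(** The equation makes the principal part of -g equal to l g (1 + g_x^2) >= 0. Adding eta x^2 makes
    it strictly positive, which excludes an interior maximum. *)
Lemma lower_bound (m : R) : (forall p, bdry Om p -> m <= g p) ->
  forall p, closure Om p -> m <= g p.
Proof.
move=> mb p cp; apply/ler_addgt0Pr => e e0.
have cx2 : {within closure Om, continuous (fun q : plane => q.1 * q.1)}.
  by apply: within_continuousM; exact: continuous_x.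
pose X := max_on (closure Om) (fun q : plane => q.1 * q.1).
have X0 : 0 <= X.
  by apply: le_trans (max_onP _ _ p cO cx2 cp); rewrite -expr2 sqr_ge0.
have X1 : 0 < X + 1 by lra.
(* The perturbation then costs at most e on the closure; X + 1 avoids a division by 0. *)
pose eta := e / (X + 1).
have eta0 : 0 < eta by rewrite divr_gt0.
have etaX : eta * (X + 1) = e by rewrite divfK// gt_eqF.
have cF : {within closure Om, continuous (fun q : plane => eta * (q.1 * q.1) - g q)}.
  by apply: within_continuousB => //; exact: within_continuousZ.
have bF q : bdry Om q -> eta * (q.1 * q.1) - g q <= e - m.
  move=> bq; have := mb q bq; have := max_onP _ _ q cO cx2 bq.1 : q.1 * q.1 <= X.
  by rewrite -etaX => h1 h2; have := ler_wpM2l (ltW eta0) h1; lra.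
clearbody eta.
suff H : forall q, Om q -> ~ (forall q', Om q' ->
    eta * (q'.1 * q'.1) - g q' <= eta * (q.1 * q.1) - g q).
  have := max_principle _ cO oOm cF H bF p cp; have := mulr_ge0 (ltW eta0) (sqr_ge0 p.1); rewrite expr2; lra.
move=> {cp} {}p Op H.
have jx := jets_affine p 1 0 0.
have jF := jetsB (jetsZ eta (jetsM jx jx)) (jets_C2 oOm g2 Op).
have [|_ _ /(principal_part_max Op)] := jets_max oOm Op _ jF.
  by move=> q Oq /=; have := H q Oq; lra.
have := geq p Op; have gp := g0 p Op.
move: (dx g p) (dt g p) (dx (dx g) p) (dt (dx g) p) (dt (dt g) p) => P Q A B C E.
have T1 : 0 < (g p ^+ 2 + Q ^+ 2 + eps) * eta.
  by rewrite mulr_gt0// principal_coef_gt0.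
have T2 : 0 <= l * g p * (1 + P ^+ 2).
  by rewrite !mulr_ge0 ?(ltW gp)//; have := sqr_ge0 P; lra.
lra.
Qed.

(** The curves y^2 + (x - x0)^2 = const are geodesics of the half-plane, which suggests the
    comparison function. Its principal part is 2 (1 - l) g^2 (1 + g_x^2) + 2 eps (1 + g_x^2) + 4
    g_t^2 >= 0, and eta t^2 makes it strict. *)
Lemma upper_bound (x0 M2 : R) :
  (forall p, bdry Om p -> g p ^+ 2 + (p.1 - x0) ^+ 2 <= M2) ->
  forall p, closure Om p -> g p ^+ 2 + (p.1 - x0) ^+ 2 <= M2.
Proof.
move=> mb p cp; apply/ler_addgt0Pr => e e0.
have cx2 : {within closure Om, continuous (fun q : plane => q.2 * q.2)}.
  by apply: within_continuousM; exact: continuous_t.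
pose X := max_on (closure Om) (fun q : plane => q.2 * q.2).
have X0 : 0 <= X.
  by apply: le_trans (max_onP _ _ p cO cx2 cp); rewrite -expr2 sqr_ge0.
have X1 : 0 < X + 1 by lra.
pose eta := e / (X + 1).
have eta0 : 0 < eta by rewrite divr_gt0.
have etaX : eta * (X + 1) = e by rewrite divfK// gt_eqF.
pose ax (q : plane) := 1 * q.1 + 0 * q.2 - x0.
have axE q : ax q = q.1 - x0 by rewrite /ax; ring.
pose F (q : plane) := g q * g q + ax q * ax q + eta * (q.2 * q.2).
have cF : {within closure Om, continuous F}.
  apply: within_continuousD; last exact: within_continuousZ.
  by apply: within_continuousD; apply: within_continuousM => //; exact: continuous_affine.
have bF q : bdry Om q -> F q <= M2 + e.
  move=> bq; have := mb q bq; have := max_onP _ _ q cO cx2 bq.1 : q.2 * q.2 <= X.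
  rewrite -etaX /F axE => h1 h2; have := ler_wpM2l (ltW eta0) h1; lra.
clearbody eta.
suff H : forall q, Om q -> ~ (forall q', Om q' -> F q' <= F q).
  have := max_principle _ cO oOm cF H bF p cp; have := mulr_ge0 (ltW eta0) (sqr_ge0 p.2).
  by rewrite /F axE expr2; lra.
move=> {cp} {}p Op H.
have jx := jets_affine p 1 0 (- x0).
have jt := jets_affine p 0 1 0.
have jg := jets_C2 oOm g2 Op.
have jF := jetsD (jetsD (jetsM jg jg) (jetsM jx jx)) (jetsZ eta (jetsM jt jt)).
have [|_ _ /(principal_part_max Op)] := jets_max oOm Op _ jF.
  by move=> q Oq /=; have := H q Oq; rewrite /F /ax; lra.
have := geq p Op; have gp := g0 p Op.
move: (dx g p) (dt g p) (dx (dx g) p) (dt (dx g) p) (dt (dt g) p) (g p) gp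
  => P Q A B C G gp E.
have P2 : 0 < 1 + P ^+ 2 by have := sqr_ge0 P; lra.
have T1 : 0 < eta * (1 + P ^+ 2) by rewrite mulr_gt0.
have T2 : 0 <= (1 - l) * G ^+ 2 * (1 + P ^+ 2).
  by apply: mulr_ge0 (ltW P2); apply: mulr_ge0 (sqr_ge0 G); rewrite subr_ge0.
have T3 : 0 <= eps * (1 + P ^+ 2) by rewrite mulr_ge0 ?(ltW P2).
have T4 := sqr_ge0 Q.
have := congr1 (fun x => 2 * G * x) E; rewrite mulr0.
lra.
Qed.

(** The sign [sg] treats g - phi and phi - g at once; n1 x + n2 t + c is the distance to a line that
    has the closure on one side. *)
Lemma boundary_barrier (phi : plane -> R) (K M mu nu D0 n1 n2 c sg : R) :
  eps <= 1 -> {within closure Om, continuous phi} -> C2 Om phi -> 0 <= K ->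
  (forall p, Om p -> dx phi p ^+ 2 + dt phi p ^+ 2 <= K ^+ 2) ->
  (forall p, Om p -> [/\ `|dx (dx phi) p| <= K, `|dt (dx phi) p| <= K &
                         `|dt (dt phi) p| <= K]) ->
  0 < mu -> mu <= 1 -> (forall p, Om p -> mu <= g p ^+ 2) ->
  (forall p, Om p -> g p <= M) -> `|sg| = 1 -> 0 < nu ->
  K * (M ^+ 2 + 6 + 4 * K ^+ 2) + M * (3 + 2 * K ^+ 2) < nu * mu ->
  (forall p, bdry Om p -> g p = phi p) ->
  (forall p, Om p -> sg * (g p - phi p) <= D0) ->
  n1 ^+ 2 + n2 ^+ 2 = 1 ->
  (forall p, closure Om p -> 0 <= n1 * p.1 + n2 * p.2 + c) ->
  forall p, closure Om p ->
    sg * (g p - phi p) <= expR (nu * D0) * (n1 * p.1 + n2 * p.2 + c).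
Proof.
move=> eps1 cphi phi2 K0 HK HK2 mu0 mu1 Hmu HM sg1 nu0 Hnu gphi HD0 n12 d0 p cp.
(* With u = sg (g - phi), a critical point of F satisfies exp(nu u) |Du| = D, while exp(nu u) <= D:
   this k forces |Du| >= 1 there. *)
pose D := expR (nu * D0); pose k := nu * D.
have D_gt0 : 0 < D by exact: expR_gt0.
have k0 : 0 < k by rewrite mulr_gt0.
pose F q := expR (nu * (sg * (g q - phi q))) - k * (n1 * q.1 + n2 * q.2 + c).
have cF : {within closure Om, continuous F}.
  apply: within_continuousB; last by apply: within_continuousZ; exact: continuous_affine.
  apply: within_continuous_comp; first exact: continuous_expR.
  by do 2 apply: within_continuousZ; exact: within_continuousB.
have bF q : bdry Om q -> F q <= 1.
  move=> bq; rewrite /F (gphi q bq) subrr !mulr0 expR0 gerBl.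
  by rewrite mulr_ge0 ?(ltW k0) ?d0//; case: bq.
have Fp : F p <= 1.
  apply: (max_principle _ cO oOm cF _ bF p cp) => {cp} {}p Op H.
  have jg := jets_C2 oOm g2 Op; have jphi := jets_C2 oOm phi2 Op.
  have jF := jetsB (jets_expR (jetsZ nu (jetsZ sg (jetsB jg jphi))))
    (jetsZ k (jets_affine p n1 n2 c)).
  have [//|HA HB /(principal_part_max Op) HH] := jets_max oOm Op _ jF.
  have Ep : 0 < expR (nu * (sg * (g p - phi p))) by exact: expR_gt0.
  have ED : expR (nu * (sg * (g p - phi p))) <= D.
    by rewrite ler_expR ler_wpM2l ?(ltW nu0)// HD0.
  have s2 : sg ^+ 2 = 1 by rewrite -real_normK ?num_real// sg1 expr1n.
  have [K1 K2 K3] := HK2 p Op; have KK := HK p Op; have gp := g0 p Op.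
  move: (geq p Op) (HM p Op) (Hmu p Op) K1 K2 K3 KK gp Ep ED HA HB HH.
  move: (expR _) => E; move: (g p) (dx g p) (dt g p) (dx (dx g) p) (dt (dx g) p) (dt (dt g) p)
   (dx phi p) (dt phi p) (dx (dx phi) p) (dt (dx phi) p) (dt (dt phi) p)
   => G P Q A B C P' Q' A' B' C' geqp GM Gmu K1 K2 K3 KK G0 E0 ED HA HB HH.
  have HA' : E * (sg * (P - P')) = D * n1.
    by apply: (mulfI (lt0r_neq0 nu0)); move: HA; rewrite /k; lra.
  have HB' : E * (sg * (Q - Q')) = D * n2.
    by apply: (mulfI (lt0r_neq0 nu0)); move: HB; rewrite /k; lra.
  have S1 : 1 <= (P - P') ^+ 2 + (Q - Q') ^+ 2.
    rewrite -(@ler_pM2l _ (E ^+ 2)) ?exprn_gt0// mulr1.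
    have -> : E ^+ 2 * ((P - P') ^+ 2 + (Q - Q') ^+ 2) = D ^+ 2.
      have -> : D ^+ 2 = (D * n1) ^+ 2 + (D * n2) ^+ 2.
        by rewrite -[LHS]mulr1 -n12; ring.
      by rewrite -HA' -HB' -[LHS]mulr1 -s2; ring.
    by rewrite lerXn2r// nnegrE ltW// (lt_le_trans E0).
  apply: (barrier_algebra R G P Q A B C P' Q' A' B' C' eps l K M mu nu sg) => //.
  have En : 0 < E * nu by rewrite mulr_gt0.
  rewrite -(pmulr_rle0 _ En); move: HH.
  have -> : (nu * (sg * (P - P'))) ^+ 2 = nu ^+ 2 * (P - P') ^+ 2 * sg ^+ 2 by ring.
  have -> : (nu * (sg * (Q - Q'))) ^+ 2 = nu ^+ 2 * (Q - Q') ^+ 2 * sg ^+ 2 by ring.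
  have -> : (nu * (sg * (P - P'))) * (nu * (sg * (Q - Q'))) =
    nu ^+ 2 * ((P - P') * (Q - Q')) * sg ^+ 2 by ring.
  rewrite s2 => HH; apply: le_trans HH; rewrite le_eqVlt; apply/orP; left.
  by apply/eqP; ring.
(* exp(y) >= 1 + y turns F <= 1 into nu u <= k d, that is, u <= D d. *)
have := expR_ge1Dx (nu * (sg * (g p - phi p))).
move: Fp; rewrite /F /k -/D => Fp h; rewrite -(@ler_pM2l _ nu)//; move: Fp h.
by move: {k k0 F cF bF D_gt0} D (expR _) => D' E; lra.
Qed.

End MaximumPrincipleEstimates.

(** * Algebra of the two-point comparison: factorization, rotated equation, gap *)

Section TwoPointAlgebra.
Context {R : realType}.

(** Lowering the entry a of (a, b; b, s^2) to (b/s)^2 can only increase the trace, as Xee <= 0, and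
    leaves the rank one matrix w (x) w with w = (b/s, s). A single test vector per point then
    represents the whole operator. *)
Lemma cholesky_le (a b s Xee Xen Xnn : R) : 0 < s -> b ^+ 2 <= a * s ^+ 2 ->
  Xee <= 0 -> a * Xee + 2 * b * Xen + s ^+ 2 * Xnn <=
    (b / s) ^+ 2 * Xee + 2 * (b / s) * s * Xen + s ^+ 2 * Xnn.
Proof.
move=> s0 H X0; have -> : 2 * (b / s) * s = 2 * b by field; rewrite gt_eqF.
rewrite -subr_ge0.
have -> : (b / s) ^+ 2 * Xee + 2 * b * Xen + s ^+ 2 * Xnn -
    (a * Xee + 2 * b * Xen + s ^+ 2 * Xnn) = (a - (b / s) ^+ 2) * - Xee by ring.
rewrite mulr_ge0 ?oppr_ge0// subr_ge0 expr_div_n ler_pdivrMr// exprn_gt0//.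
Qed.

(* The equation for v = g^3/3 in the frame (e, e^perp) with Dv = L e: there its
   coefficient matrix is g^4 diag(g^2 + eps, 1) + L^2 e^perp (x) e^perp, and its
   zeroth order part is increasing in g once L is large. *)
Lemma rotated_equation (G P Q A B C eps l L e1 e2 : R) :
  e1 ^+ 2 + e2 ^+ 2 = 1 -> G ^+ 2 * P = L * e1 -> G ^+ 2 * Q = L * e2 ->
  A * (G ^+ 2 + Q ^+ 2 + eps) + C * (1 + P ^+ 2) - 2 * P * Q * B
    + l * G * (1 + P ^+ 2) = 0 ->
  let X := G ^+ 2 * A + 2 * G * P ^+ 2 in
  let Y := G ^+ 2 * B + 2 * G * P * Q in
  let Z := G ^+ 2 * C + 2 * G * Q ^+ 2 in
  G ^+ 4 * ((G ^+ 2 + eps) * e1 ^+ 2 + e2 ^+ 2) *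
    (e1 ^+ 2 * X + 2 * e1 * e2 * Y + e2 ^+ 2 * Z) +
  2 * (G ^+ 4 * e1 * e2 * (1 - G ^+ 2 - eps)) *
    (e1 * e2 * (Z - X) + (e1 ^+ 2 - e2 ^+ 2) * Y) +
  (L ^+ 2 + G ^+ 4 * ((G ^+ 2 + eps) * e2 ^+ 2 + e1 ^+ 2)) *
    (e2 ^+ 2 * X - 2 * e1 * e2 * Y + e1 ^+ 2 * Z) =
  (2 - l) * L ^+ 2 * e1 ^+ 2 * G ^+ 3 + 2 * L ^+ 2 * (eps * e1 ^+ 2 + e2 ^+ 2) * G
    - l * G ^+ 7.
Proof.
move=> e12 HP HQ E X Y Z.
transitivity (G ^+ 4 * ((e1 ^+ 2 + e2 ^+ 2) ^+ 2 * ((G ^+ 2 + eps) * X + Z))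
  + ((L * e2) ^+ 2 * X - 2 * (L * e1) * (L * e2) * Y + (L * e1) ^+ 2 * Z)).
  by move: {HP HQ E} X Y Z => X Y Z; ring.
rewrite e12.
have -> : (2 - l) * L ^+ 2 * e1 ^+ 2 * G ^+ 3 + 2 * L ^+ 2 * (eps * e1 ^+ 2 + e2 ^+ 2) * G
    - l * G ^+ 7 = (2 - l) * (L * e1) ^+ 2 * G ^+ 3
    + 2 * (eps * (L * e1) ^+ 2 + (L * e2) ^+ 2) * G - l * G ^+ 7 by ring.
rewrite -HP -HQ /X /Y /Z.
have := congr1 (fun x => G ^+ 6 * x) E; rewrite mulr0 => {}E.
by apply/eqP; rewrite -subr_eq0 -E; apply/eqP; ring.
Qed.

Lemma expr_increment (n : nat) (G H M : R) : 0 < H -> H < G -> G <= M ->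
  0 <= G ^+ n.+1 - H ^+ n.+1 <= n.+1%:R * M ^+ n * (G - H).
Proof.
move=> H0 HG GM; have G0 := lt_trans H0 HG.
have M0 := lt_le_trans G0 GM.
have D0 : 0 <= G - H by rewrite subr_ge0 ltW.
apply/andP; split; first by
  rewrite subr_ge0 lerXn2r ?nnegrE ?(ltW H0) ?(ltW G0) ?(ltW HG).
elim: n => [|n IH]; first by rewrite mulr1 mul1r !expr1.
have -> : G ^+ n.+2 - H ^+ n.+2 =
    G * (G ^+ n.+1 - H ^+ n.+1) + H ^+ n.+1 * (G - H).
  by rewrite (exprS G n.+1) (exprS H n.+1); ring.
have -> : n.+2%:R * M ^+ n.+1 * (G - H) =
    M * (n.+1%:R * M ^+ n * (G - H)) + M ^+ n.+1 * (G - H).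
  by rewrite -[n.+2%:R]natr1 (exprS M n); ring.
apply: lerD.
  apply: ler_pM => //; first exact: ltW.
  by rewrite subr_ge0 lerXn2r ?nnegrE// ltW.
apply: ler_wpM2r => //; rewrite lerXn2r ?nnegrE ?(ltW H0) ?(ltW M0)//.
exact: le_trans (ltW HG) GM.
Qed.

(** L^2 cancels in sG^2 - sH^2, while sG + sH >= 2 L, so the roots differ by O((G - H) / L). The
    numbers 6 M^5 and 4 M^3 bound the derivatives of G^6 and G^4. *)
Lemma root_increment (G H M eps L e1 e2 sG sH : R) :
  e1 ^+ 2 + e2 ^+ 2 = 1 -> 0 < H -> H < G -> G <= M -> 0 <= eps -> eps <= 1 ->
  0 < L -> 0 < sG -> 0 < sH ->
  sG ^+ 2 = L ^+ 2 + G ^+ 4 * ((G ^+ 2 + eps) * e2 ^+ 2 + e1 ^+ 2) ->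
  sH ^+ 2 = L ^+ 2 + H ^+ 4 * ((H ^+ 2 + eps) * e2 ^+ 2 + e1 ^+ 2) ->
  4 * L ^+ 2 * (sG - sH) ^+ 2 <= ((6 * M ^+ 5 + 4 * M ^+ 3) * (G - H)) ^+ 2.
Proof.
move=> e12 H0 HG GM eps0 eps1 L0 sG0 sH0 HsG HsH.
have /andP[d4 c4] := expr_increment 3 G H M H0 HG GM.
have /andP[d6 c6] := expr_increment 5 G H M H0 HG GM.
have G0 := lt_trans H0 HG.
have e20 := sqr_ge0 e2; have e10 := sqr_ge0 e1.
have e21 : e2 ^+ 2 <= 1 by rewrite -e12 lerDr.
have f0 : 0 <= eps * e2 ^+ 2 + e1 ^+ 2 by rewrite addr_ge0// mulr_ge0.
have f1 : eps * e2 ^+ 2 + e1 ^+ 2 <= 1.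
  by rewrite -e12 [leRHS]addrC lerD2r -[leRHS]mul1r ler_wpM2r.
have sE : sG ^+ 2 - sH ^+ 2 = e2 ^+ 2 * (G ^+ 6 - H ^+ 6)
    + (eps * e2 ^+ 2 + e1 ^+ 2) * (G ^+ 4 - H ^+ 4) by rewrite HsG HsH; ring.
have d0 : 0 <= sG ^+ 2 - sH ^+ 2.
  by rewrite sE; apply: addr_ge0; [exact: mulr_ge0 e20 d6|exact: mulr_ge0 f0 d4].
have dC : sG ^+ 2 - sH ^+ 2 <= (6 * M ^+ 5 + 4 * M ^+ 3) * (G - H).
  rewrite sE [leRHS]mulrDl; apply: lerD.
    by apply: le_trans c6; rewrite -[leRHS]mul1r; exact: ler_wpM2r.
  by apply: le_trans c4; rewrite -[leRHS]mul1r; exact: ler_wpM2r.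
have sL x y : 0 < x -> 0 < y ->
    x ^+ 2 = L ^+ 2 + y ^+ 4 * ((y ^+ 2 + eps) * e2 ^+ 2 + e1 ^+ 2) -> L <= x.
  move=> x0 y0 E; rewrite -(@ler_pXn2r _ 2) ?nnegrE ?(ltW L0) ?(ltW x0)// E lerDl.
  apply: mulr_ge0; first by rewrite exprn_ge0// ltW.
  apply: addr_ge0 e10; apply: mulr_ge0 e20; exact: addr_ge0 (sqr_ge0 y) eps0.
have sGL := sL _ _ sG0 G0 HsG; have sHL := sL _ _ sH0 H0 HsH.
have LL : (2 * L) ^+ 2 <= (sG + sH) ^+ 2.
  have -> : 2 * L = L + L by ring.
  by rewrite lerXn2r ?nnegrE ?lerD// ?addr_ge0// ltW.
apply: (@le_trans _ _ ((sG ^+ 2 - sH ^+ 2) ^+ 2)); last first.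
  by rewrite lerXn2r ?nnegrE// (le_trans d0).
have -> : (sG ^+ 2 - sH ^+ 2) ^+ 2 = (sG + sH) ^+ 2 * (sG - sH) ^+ 2 by ring.
have -> : 4 * L ^+ 2 = (2 * L) ^+ 2 by ring.
exact: ler_wpM2r (sqr_ge0 _) _ _ LL.
Qed.

(** The coupling error is quadratic in G - H and divided by L r. The bound 2 L r on the increment of
    the cubes trades one factor G - H for 2 L r / mu, so the error becomes linear with a factor free
    of L and r. The zeroth order part gains mu L^2 (G - H) and loses at most 7 M^6 (G - H) through
    G^7. *)
Lemma two_point_gap (G H m M mu eps l L r e1 e2 sG sH : R) :
  e1 ^+ 2 + e2 ^+ 2 = 1 -> 0 < m -> m <= H -> H < G -> G <= M ->
  0 <= eps -> eps <= 1 -> 0 <= l -> l <= 1 -> 0 < mu -> mu <= 1 -> mu <= m ^+ 2 ->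
  0 < L -> 0 < r ->
  7 * M ^+ 6 + (6 * M ^+ 5 + 4 * M ^+ 3) ^+ 2 / (2 * mu) < mu * L ^+ 2 ->
  G ^+ 3 / 3 - H ^+ 3 / 3 <= 2 * L * r -> 0 < sG -> 0 < sH ->
  sG ^+ 2 = L ^+ 2 + G ^+ 4 * ((G ^+ 2 + eps) * e2 ^+ 2 + e1 ^+ 2) ->
  sH ^+ 2 = L ^+ 2 + H ^+ 4 * ((H ^+ 2 + eps) * e2 ^+ 2 + e1 ^+ 2) ->
  L / r * (sG - sH) ^+ 2 <
  ((2 - l) * L ^+ 2 * e1 ^+ 2 * G ^+ 3 + 2 * L ^+ 2 * (eps * e1 ^+ 2 + e2 ^+ 2) * G
    - l * G ^+ 7) -
  ((2 - l) * L ^+ 2 * e1 ^+ 2 * H ^+ 3 + 2 * L ^+ 2 * (eps * e1 ^+ 2 + e2 ^+ 2) * H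
    - l * H ^+ 7).
Proof.
move=> e12 m0 mH HG GM eps0 eps1 l0 l1 mu0 mu1 mum L0 r0 HL Hv sG0 sH0 HsG HsH.
have H0 := lt_le_trans m0 mH; have G0 := lt_trans H0 HG.
have D0 : 0 < G - H by rewrite subr_gt0.
have := root_increment G H M eps L e1 e2 sG sH
  e12 H0 HG GM eps0 eps1 L0 sG0 sH0 HsG HsH.
move: {HsG HsH sG0 sH0} HL; move: (6 * M ^+ 5 + 4 * M ^+ 3) => C HL gap1.
have /andP[d7 c7] := expr_increment 6 G H M H0 HG GM.
have c3 : 3 * mu * (G - H) <= G ^+ 3 - H ^+ 3.
  have -> : G ^+ 3 - H ^+ 3 = (G ^+ 2 + H * G + H ^+ 2) * (G - H) by ring.
  rewrite ler_pM2r//; have -> : 3 * mu = mu + mu + mu by ring.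
  have mm a b : m <= a -> m <= b -> mu <= a * b.
    by move=> ma mb; apply: (le_trans mum); rewrite expr2 ler_pM// ltW.
  by have mG := le_trans mH (ltW HG); rewrite !expr2; do 2?apply: lerD; exact: mm.
have gap2 : mu * (G - H) <= 2 * L * r by move: c3 Hv; clear; lra.
have gap3 : L / r * (sG - sH) ^+ 2 <= C ^+ 2 / (2 * mu) * (G - H).
  rewrite -(@ler_pM2l _ (4 * L * r * mu)); last by rewrite !mulr_gt0.
  have -> : 4 * L * r * mu * (L / r * (sG - sH) ^+ 2) =
     mu * (4 * L ^+ 2 * (sG - sH) ^+ 2) by field; rewrite gt_eqF.
  have -> : 4 * L * r * mu * (C ^+ 2 / (2 * mu) * (G - H)) =
     (2 * L * r) * (C ^+ 2 * (G - H)) by field; rewrite gt_eqF.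
  apply: (le_trans (ler_wpM2l (ltW mu0) gap1)).
  have -> : mu * (C * (G - H)) ^+ 2 = mu * (G - H) * (C ^+ 2 * (G - H)) by ring.
  by apply: ler_wpM2r => //; rewrite mulr_ge0 ?sqr_ge0// ltW.
apply: (le_lt_trans gap3).
apply: (@lt_le_trans _ _ ((mu * L ^+ 2 - 7 * M ^+ 6) * (G - H))).
  by rewrite ltr_pM2r// ltrBrDl.
have L20 : 0 < L ^+ 2 by rewrite exprn_gt0.
have a10 : 0 <= L ^+ 2 * e1 ^+ 2 by exact: mulr_ge0 (ltW L20) (sqr_ge0 e1).
have a20 : 0 <= L ^+ 2 * e2 ^+ 2 by exact: mulr_ge0 (ltW L20) (sqr_ge0 e2).
have d3 : 0 <= G ^+ 3 - H ^+ 3.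
  by apply: le_trans c3; rewrite !mulr_ge0// ltW.
have p1 : 0 <= (1 - l) * (L ^+ 2 * e1 ^+ 2) * (G ^+ 3 - H ^+ 3).
  by apply: mulr_ge0 d3; apply: mulr_ge0 a10; rewrite subr_ge0.
have p2 := ler_wpM2l a10 c3.
have p3 : 0 <= L ^+ 2 * e1 ^+ 2 * (mu * (G - H)).
  exact: mulr_ge0 a10 (mulr_ge0 (ltW mu0) (ltW D0)).
have p4 : 0 <= eps * (L ^+ 2 * e1 ^+ 2) * (G - H).
  exact: mulr_ge0 (mulr_ge0 eps0 a10) (ltW D0).
have p7 := mulr_ge0 a20 (ltW D0).
have p5 := ler_wpM2r p7 mu1.
have p6 : l * (G ^+ 7 - H ^+ 7) <= 7 * M ^+ 6 * (G - H).
  by apply: le_trans c7; rewrite -[leRHS]mul1r; exact: ler_wpM2r.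
have -> : mu * L ^+ 2 = mu * L ^+ 2 * (e1 ^+ 2 + e2 ^+ 2) by rewrite e12 mulr1.
move: p1 p2 p3 p4 p5 p6 p7; clear; lra.
Qed.

End TwoPointAlgebra.

(** * First and second order conditions at a maximum over pairs of points *)

Section TwoPointMaximum.
Context {R : realType}.
Local Notation plane := (R * R)%type.
Implicit Types (p q w : plane).
#[local] Opaque dx dt.

Lemma enorm_ge0 p : 0 <= enorm p.
Proof. exact: sqrtr_ge0. Qed.

Lemma enormB p q : enorm (p - q) = enorm (q - p).
Proof. by rewrite /enorm -sqrrN opprB -[in LHS](sqrrN (p.2 - q.2)) opprB. Qed.

Lemma enorm_eq0 p : enorm p = 0 -> p = 0.
Proof.
rewrite /enorm => /eqP; rewrite sqrtr_eq0 => H.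
have := sqr_ge0 p.1; have := sqr_ge0 p.2 => h1 h2.
have /eqP : p.1 ^+ 2 = 0 by lra.
have /eqP : p.2 ^+ 2 = 0 by lra.
by rewrite !sqrf_eq0 => /eqP h3 /eqP h4; rewrite (surjective_pairing p) h3 h4.
Qed.

(* sqrt (a^2 + b^2) <= a + b^2 / (2 a) avoids differentiating the norm. *)
Lemma sqrt_sum_sqr_le (a b : R) : 0 < a ->
  Num.sqrt (a ^+ 2 + b ^+ 2) <= a + b ^+ 2 / (2 * a).
Proof.
move=> a0; have h : 0 <= b ^+ 2 / (2 * a).
  by apply: divr_ge0; rewrite ?sqr_ge0// mulr_ge0// ltW.
have n0 : 0 <= a + b ^+ 2 / (2 * a) by rewrite addr_ge0// ltW.
rewrite -[leRHS](ger0_norm n0) -sqrtr_sqr ler_sqrt ?sqr_ge0//.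
have -> : (a + b ^+ 2 / (2 * a)) ^+ 2 = a ^+ 2 + b ^+ 2 + (b ^+ 2 / (2 * a)) ^+ 2.
  by field; rewrite gt_eqF.
by rewrite lerDl sqr_ge0.
Qed.

Lemma jet_norm_bound (r c d : R) : 0 < r ->
  jet (fun t => r + c * t + (d * t) ^+ 2 / (2 * (r + c * t))) r c (d ^+ 2 / (2 * r)).
Proof.
move=> r0; exists (fun t => d ^+ 2 / (2 * (r + c * t))); split.
- have cl : {for 0, continuous (fun t => 2 * (r + c * t))}.
    apply: cvgM; first exact: cvg_cst.
    apply: cvgD; first exact: cvg_cst.
    by apply: cvgM; [exact: cvg_cst|exact: cvg_id].
  apply: cvgM; first exact: cvg_cst.
  by apply: cvgV => //; rewrite mulr0 addr0 mulf_neq0// gt_eqF.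
- by rewrite mulr0 addr0.
- by near=> t; rewrite exprMn mulrAC.
Unshelve. all: by end_near. Qed.

(** Both points move, p along a and q along b. To second order the distance sees only relative
    motion orthogonal to e: in the frame (e, e^perp) the components x and x' are free and only y -
    y' is penalized. *)
Lemma two_point_max {Om v p q L A B X Y Z A' B' X' Y' Z' r e1 e2} :
  open Om -> Om p -> Om q -> 0 < r -> p.1 - q.1 = r * e1 -> p.2 - q.2 = r * e2 ->
  e1 ^+ 2 + e2 ^+ 2 = 1 -> 0 <= L ->
  jets v p A B X Y Z -> jets v q A' B' X' Y' Z' ->
  (forall p' q', Om p' -> Om q' ->
    v p' - v q' - L * enorm (p' - q') <= v p - v q - L * r) ->
  [/\ A = L * e1 /\ B = L * e2, A' = L * e1 /\ B' = L * e2 &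
    forall x y x' y',
    ((x * e1 - y * e2) ^+ 2 * X + 2 * (x * e1 - y * e2) * (x * e2 + y * e1) * Y
      + (x * e2 + y * e1) ^+ 2 * Z) -
    ((x' * e1 - y' * e2) ^+ 2 * X' + 2 * (x' * e1 - y' * e2) * (x' * e2 + y' * e1) * Y'
      + (x' * e2 + y' * e1) ^+ 2 * Z') <= L / r * (y - y') ^+ 2].
Proof.
move=> oOm Op Oq r0 hr1 hr2 e12 L0 jp jq H.
have key a b :
  (a.1 * A + a.2 * B) - (b.1 * A' + b.2 * B')
    - L * ((a.1 - b.1) * e1 + (a.2 - b.2) * e2) = 0 /\
  (a.1 ^+ 2 * X + 2 * a.1 * a.2 * Y + a.2 ^+ 2 * Z) / 2 -
  (b.1 ^+ 2 * X' + 2 * b.1 * b.2 * Y' + b.2 ^+ 2 * Z') / 2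
    - L * (((a.2 - b.2) * e1 - (a.1 - b.1) * e2) ^+ 2 / (2 * r)) <= 0.
  set c := _ * e1 + _ * e2; set d := _ * e1 - _ * e2.
  have jN := jet_norm_bound _ c d r0.
  apply: (jet_max (jetB (jetB (jp a) (jq b)) (jetZ L jN))).
  rewrite !ray0 mulr0 addr0 mulr0 expr0n mul0r addr0.
  have pos : \forall t \near (0 : R), 0 < r + c * t.
    have /cvgr_gt : (r + c * t) @[t --> (0 : R)] --> r + c * 0.
      apply: cvgD; first exact: cvg_cst.
      by apply: cvgM; [exact: cvg_cst|exact: cvg_id].
    by rewrite mulr0 addr0 => /(_ 0 r0).
  have np := near_ray Om p a oOm Op; have nq := near_ray Om q b oOm Oq.
  apply: filterS3 pos np nq => t post Opt Oqt.
  (* The norm is replaced by a larger function that equals it at t = 0, so the maximum at t = 0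
     persists. *)
  apply: (@le_trans _ _ (v (ray p a t) - v (ray q b t) -
      L * enorm (ray p a t - ray q b t))); last exact: H.
  rewrite lerD2l lerN2 ler_wpM2l//.
  apply: le_trans (sqrt_sum_sqr_le _ (d * t) post); rewrite /enorm.
  rewrite le_eqVlt; apply/orP; left; apply/eqP; congr Num.sqrt; rewrite /ray /=.
  have -> : p.1 + t * a.1 - (q.1 + t * b.1) = r * e1 + t * (a.1 - b.1).
    by rewrite -hr1; ring.
  have -> : p.2 + t * a.2 - (q.2 + t * b.2) = r * e2 + t * (a.2 - b.2).
    by rewrite -hr2; ring.
  rewrite /c /d.
  transitivity (r ^+ 2 * (e1 ^+ 2 + e2 ^+ 2)
    + 2 * r * t * ((a.1 - b.1) * e1 + (a.2 - b.2) * e2)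
    + t ^+ 2 * ((a.1 - b.1) ^+ 2 + (a.2 - b.2) ^+ 2)); first by ring.
  transitivity (r ^+ 2
    + 2 * r * t * ((a.1 - b.1) * e1 + (a.2 - b.2) * e2)
    + t ^+ 2 * (e1 ^+ 2 + e2 ^+ 2) * ((a.1 - b.1) ^+ 2 + (a.2 - b.2) ^+ 2)).
    by rewrite e12; ring.
  by ring.
split.
- have [h1 _] := key (1, 0) (0, 0); have [h2 _] := key (0, 1) (0, 0).
  by move: h1 h2 => /=; split; lra.
- have [h1 _] := key (0, 0) (1, 0); have [h2 _] := key (0, 0) (0, 1).
  by move: h1 h2 => /=; split; lra.
move=> x y x' y'.
have [_] := key (x * e1 - y * e2, x * e2 + y * e1) (x' * e1 - y' * e2, x' * e2 + y' * e1).
move=> /=.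
have -> : (x * e2 + y * e1 - (x' * e2 + y' * e1)) * e1
    - (x * e1 - y * e2 - (x' * e1 - y' * e2)) * e2
    = (y - y') * (e1 ^+ 2 + e2 ^+ 2) by ring.
rewrite e12 mulr1.
have -> : L * ((y - y') ^+ 2 / (2 * r)) = (L / r * (y - y') ^+ 2) / 2.
  by field; rewrite gt_eqF.
lra.
Qed.

End TwoPointMaximum.

(** * Halving the Lipschitz constant of g^3/3 *)

Section InteriorLipschitz.
Context {R : realType}.
Local Notation plane := (R * R)%type.
Implicit Types (p q w : plane).
#[local] Opaque dx dt.

(** In the frame (e, e^perp) the coefficient matrix is (a, b; b, s^2), with b^2 <= a s^2 by
    ellipticity, so [cholesky_le] applies. The component b/s along e stays existential because the
    two-point inequality does not penalize it. *)
Lemma principal_part_le (G eps L e1 e2 s X Y Z : R) :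
  e1 ^+ 2 + e2 ^+ 2 = 1 -> 0 <= eps -> 0 < s ->
  s ^+ 2 = L ^+ 2 + G ^+ 4 * ((G ^+ 2 + eps) * e2 ^+ 2 + e1 ^+ 2) ->
  e1 ^+ 2 * X + 2 * e1 * e2 * Y + e2 ^+ 2 * Z <= 0 ->
  exists x : R,
  G ^+ 4 * ((G ^+ 2 + eps) * e1 ^+ 2 + e2 ^+ 2) *
    (e1 ^+ 2 * X + 2 * e1 * e2 * Y + e2 ^+ 2 * Z) +
  2 * (G ^+ 4 * e1 * e2 * (1 - G ^+ 2 - eps)) *
    (e1 * e2 * (Z - X) + (e1 ^+ 2 - e2 ^+ 2) * Y) +
  (L ^+ 2 + G ^+ 4 * ((G ^+ 2 + eps) * e2 ^+ 2 + e1 ^+ 2)) *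
    (e2 ^+ 2 * X - 2 * e1 * e2 * Y + e1 ^+ 2 * Z)
  <= (x * e1 - s * e2) ^+ 2 * X + 2 * (x * e1 - s * e2) * (x * e2 + s * e1) * Y
     + (x * e2 + s * e1) ^+ 2 * Z.
Proof.
move=> e12 eps0 s0 s2 X0.
set a := G ^+ 4 * (_ + _); set b := G ^+ 4 * _ * _ * _.
exists (b / s); rewrite -s2.
have H : b ^+ 2 <= a * s ^+ 2.
  rewrite s2 /a /b -subr_ge0.
  have -> : G ^+ 4 * ((G ^+ 2 + eps) * e1 ^+ 2 + e2 ^+ 2) *
      (L ^+ 2 + G ^+ 4 * ((G ^+ 2 + eps) * e2 ^+ 2 + e1 ^+ 2)) -
      (G ^+ 4 * e1 * e2 * (1 - G ^+ 2 - eps)) ^+ 2 =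
    (G ^+ 2) ^+ 2 * ((G ^+ 2 + eps) * e1 ^+ 2 + e2 ^+ 2) * L ^+ 2 +
    (G ^+ 4) ^+ 2 * (G ^+ 2 + eps) * (e1 ^+ 2 + e2 ^+ 2) ^+ 2 by ring.
  have k0 : 0 <= G ^+ 2 + eps by rewrite addr_ge0// sqr_ge0.
  rewrite e12 expr1n mulr1.
  apply: addr_ge0 (mulr_ge0 (sqr_ge0 _) k0); apply: mulr_ge0 (sqr_ge0 L).
  apply: (mulr_ge0 (sqr_ge0 _)).
  exact: addr_ge0 (mulr_ge0 k0 (sqr_ge0 e1)) (sqr_ge0 e2).
apply: le_trans (cholesky_le a b s _ _ _ s0 H X0) _.
by rewrite le_eqVlt; apply/orP; left; apply/eqP; move: (b / s) => x; ring.
Qed.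

Lemma jets_cube {g : plane -> R} {p P Q A B C} : jets g p P Q A B C ->
  jets (fun q => g q ^+ 3 / 3) p (g p ^+ 2 * P) (g p ^+ 2 * Q)
    (g p ^+ 2 * A + 2 * g p * P ^+ 2) (g p ^+ 2 * B + 2 * g p * P * Q)
    (g p ^+ 2 * C + 2 * g p * Q ^+ 2).
Proof.
move=> jg; have j3 := jetsZ 3^-1 (jetsM jg (jetsM jg jg)).
have E : (fun q => 3^-1 * (g q * (g q * g q))) = (fun q => g q ^+ 3 / 3).
  by apply/funext => q; field.
by rewrite E in j3; move: j3; congr jets; field.
Qed.

Lemma enorm_continuous : continuous (enorm : plane -> R).
Proof.
move=> p; apply: (@continuous_comp _ _ _ (fun p : plane => p.1 ^+ 2 + p.2 ^+ 2) Num.sqrt).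
  apply: cvgD; apply: (@continuous_comp _ _ _ _ (fun x : R => x ^+ 2));
    do ?exact: exprn_continuous; [exact: cvg_fst|exact: cvg_snd].
exact: sqrt_continuous.
Qed.

Lemma enormB_continuous : continuous (fun z : plane * plane => enorm (z.1 - z.2)).
Proof.
move=> z; apply: (@continuous_comp _ _ _ (fun z : plane * plane => z.1 - z.2) enorm);
  last exact: enorm_continuous.
by apply: (@cvgB _ plane); [exact: cvg_fst|exact: cvg_snd].
Qed.

Lemma closure_bdryVin (Om : set plane) p : open Om -> closure Om p ->
  bdry Om p \/ Om p.
Proof.
move=> oOm cp; have [Op|nOp] := pselect (Om p); [by right|left].
by split=> //; rewrite (interior_id _).1.
Qed.

Lemma lipschitz_halving (Om : set plane) (g : plane -> R) (eps l L m M mu : R) :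
  open Om -> compact (closure Om) -> {within closure Om, continuous g} -> C2 Om g ->
  hyperbolic_eq eps l Om g -> 0 <= eps -> eps <= 1 -> 0 <= l -> l <= 1 ->
  0 < m -> (forall p, closure Om p -> m <= g p) ->
  (forall p, closure Om p -> g p <= M) ->
  0 < mu -> mu <= 1 -> mu <= m ^+ 2 -> 0 < L ->
  7 * M ^+ 6 + (6 * M ^+ 5 + 4 * M ^+ 3) ^+ 2 / (2 * mu) < mu * L ^+ 2 ->
  (forall p q, closure Om p -> closure Om q ->
    g p ^+ 3 / 3 - g q ^+ 3 / 3 <= 2 * L * enorm (p - q)) ->
  (forall p q, closure Om p -> closure Om q -> bdry Om p \/ bdry Om q ->
    g p ^+ 3 / 3 - g q ^+ 3 / 3 <= L * enorm (p - q)) ->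
  forall p q, closure Om p -> closure Om q ->
    g p ^+ 3 / 3 - g q ^+ 3 / 3 <= L * enorm (p - q).
Proof.
move=> oOm cO cg g2 geq eps0 eps1 l0 l1 m0 gm gM mu0 mu1 mum L0 HL H2 Hb p0 q0 cp0 cq0.
pose v q := g q ^+ 3 / 3.
have cv : {within closure Om, continuous v}.
  apply: (within_continuous_comp _ _ (fun x => x ^+ 3 / 3)) => // x.
  by apply: cvgM; [exact: exprn_continuous|exact: cvg_cst].
pose F (z : plane * plane) := v z.1 - v z.2 - L * enorm (z.1 - z.2).
have cF : {within closure Om `*` closure Om, continuous F}.
  apply: within_continuousB.
    apply: within_continuousB; first exact: within_continuous_fst.
    exact: within_continuous_snd.
  apply: within_continuousM; first by move=> x; exact: cvg_cst.
  by apply: continuous_subspaceT; exact: enormB_continuous.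
have [|[p q] /[1!inE] -[/= cp cq] Hmax] :=
    compact_EVT_max _ (compact_setX cO cO) cF; first by exists (p0, q0).
have {}Hmax p' q' : closure Om p' -> closure Om q' ->
    v p' - v q' - L * enorm (p' - q') <= v p - v q - L * enorm (p - q).
  by move=> cp' cq'; have := Hmax (p', q'); rewrite /F /=; apply; rewrite inE.
rewrite -subr_le0; apply: le_trans (Hmax _ _ cp0 cq0) _.
have [bp|Op] := closure_bdryVin Om p oOm cp.
  by rewrite subr_le0; apply: Hb => //; left.
have [bq|Oq] := closure_bdryVin Om q oOm cq.
  by rewrite subr_le0; apply: Hb => //; right.
rewrite leNgt; apply/negP => Fpos.
have [r0|r0] := eqVneq (enorm (p - q)) 0.
  by move: Fpos; rewrite r0 (subr0_eq (enorm_eq0 _ r0)); lra.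
have {r0} : 0 < enorm (p - q) by rewrite lt_neqAle eq_sym r0 enorm_ge0.
have := H2 _ _ cp cq; rewrite -/(v p) -/(v q).
have rE : enorm (p - q) ^+ 2 = (p.1 - q.1) ^+ 2 + (p.2 - q.2) ^+ 2.
  by rewrite /enorm sqr_sqrtr// addr_ge0// sqr_ge0.
move: rE Fpos Hmax; move: (enorm (p - q)) => r rE Fpos Hmax H2r r0.
pose e1 := (p.1 - q.1) / r; pose e2 := (p.2 - q.2) / r.
have rn : r != 0 by rewrite gt_eqF.
have hr1 : p.1 - q.1 = r * e1 by rewrite mulrC divfK.
have hr2 : p.2 - q.2 = r * e2 by rewrite mulrC divfK.
have e12 : e1 ^+ 2 + e2 ^+ 2 = 1.
  by rewrite /e1 /e2 !expr_div_n -mulrDl -rE divff// expf_neq0.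
clearbody e1 e2.
have Hm p' q' : Om p' -> Om q' -> v p' - v q' - L * enorm (p' - q') <= v p - v q - L * r.
  by move=> ? ?; apply: Hmax; exact: subset_closure.
have := geq p Op; have := geq q Oq.
have := jets_C2 oOm g2 Op; have := jets_C2 oOm g2 Oq.
move: (dx (dx g) p) (dt (dx g) p) (dt (dt g) p) (dx g p) (dt g p) => A B C P Q.
move: (dx (dx g) q) (dt (dx g) q) (dt (dt g) q) (dx g q) (dt g q) => A' B' C' P' Q'.
move=> /jets_cube jq /jets_cube jp Eq Ep.
have [[pA pB] [qA qB]] := two_point_max oOm Op Oq r0 hr1 hr2 e12 (ltW L0) jp jq Hm.
move: (rotated_equation _ _ _ _ _ _ _ _ _ _ _ e12 pA pB Ep).
move: (rotated_equation _ _ _ _ _ _ _ _ _ _ _ e12 qA qB Eq) => /=.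
move: (g p ^+ 2 * A + 2 * g p * P ^+ 2) (g p ^+ 2 * B + 2 * g p * P * Q)
  (g p ^+ 2 * C + 2 * g p * Q ^+ 2) (g q ^+ 2 * A' + 2 * g q * P' ^+ 2)
  (g q ^+ 2 * B' + 2 * g q * P' * Q') (g q ^+ 2 * C' + 2 * g q * Q' ^+ 2)
   => X Y Z X' Y' Z' {}Eq {}Ep HQ.
(* Positivity of the maximum orders the two values, which is the direction in which the zeroth order
   part increases. *)
have GH : g q < g p.
  rewrite ltNge; apply/negP => h.
  have : v p <= v q.
    by rewrite ler_pM2r ?invr_gt0// lerXn2r// nnegrE (le_trans (ltW m0))// gm.
  by have := mulr_gt0 L0 r0; lra.
have ex_s (G : R) : exists s, 0 < s /\
    s ^+ 2 = L ^+ 2 + G ^+ 4 * ((G ^+ 2 + eps) * e2 ^+ 2 + e1 ^+ 2).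
  have sq : 0 < L ^+ 2 + G ^+ 4 * ((G ^+ 2 + eps) * e2 ^+ 2 + e1 ^+ 2).
    rewrite ltr_pwDl ?exprn_gt0//; apply: mulr_ge0.
      by rewrite (exprM G 2 2) sqr_ge0.
    apply: addr_ge0 (sqr_ge0 e1); apply: mulr_ge0 (sqr_ge0 e2).
    exact: addr_ge0 (sqr_ge0 G) eps0.
  by exists (Num.sqrt (L ^+ 2 + G ^+ 4 * ((G ^+ 2 + eps) * e2 ^+ 2 + e1 ^+ 2)));
     rewrite sqrtr_gt0 sqr_sqrtr// ltW.
have [s [s0 s2]] := ex_s (g p); have [s' [s0' s2']] := ex_s (g q).
have := two_point_gap (g p) (g q) m M mu eps l L r e1 e2 s s'
  e12 m0 (gm _ cq) GH (gM _ cp) eps0 eps1 l0 l1 mu0 mu1 mum L0 r0 HL H2r s0 s0' s2 s2'.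
(* Moving only one of the points along e costs nothing; this gives the signs needed by the Cholesky
   step. At q the Hessian enters negated. *)
have Xee : e1 ^+ 2 * X + 2 * e1 * e2 * Y + e2 ^+ 2 * Z <= 0.
  by have := HQ 1 0 0 0; lra.
have Yee : e1 ^+ 2 * - X' + 2 * e1 * e2 * - Y' + e2 ^+ 2 * - Z' <= 0.
  by have := HQ 0 0 1 0; lra.
have [x] := principal_part_le _ _ _ _ _ _ _ _ _ e12 eps0 s0 s2 Xee.
have [y] := principal_part_le _ _ _ _ _ _ _ _ _ e12 eps0 s0' s2' Yee.
(* The vectors with transverse components s and s' dominate the two operators, so the difference of
   the zeroth order parts is at most L/r (s - s')^2, against [two_point_gap]. *)
have := HQ x s y s'; rewrite Ep -Eq; lra.
Qed.

End InteriorLipschitz.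

(** * Passing between gradient bounds and Lipschitz bounds, up to the boundary *)

Section Lipschitz.
Context {R : realType}.
Local Notation plane := (R * R)%type.
Implicit Types (Om : set plane) (u h : plane -> R) (p q w : plane).
#[local] Opaque dx dt.

Lemma cauchy_schwarz (a b c d : R) :
  a * c + b * d <= Num.sqrt (a ^+ 2 + b ^+ 2) * Num.sqrt (c ^+ 2 + d ^+ 2).
Proof.
rewrite -sqrtrM ?addr_ge0 ?sqr_ge0//; apply: le_trans (ler_norm _) _.
rewrite -sqrtr_sqr ler_wsqrtr//.
by have := sqr_ge0 (a * d - b * c); lra.
Qed.

Lemma closure_lipschitz Om u (L : R) : {within closure Om, continuous u} ->
  (forall p q, Om p -> Om q -> u p - u q <= L * enorm (p - q)) ->
  forall p q, closure Om p -> closure Om q -> u p - u q <= L * enorm (p - q).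
Proof.
move=> cu H p q cp cq.
have cL q' : {within closure Om, continuous (fun p => L * enorm (p - q'))}.
  apply: within_continuousM; first by move=> x; exact: cvg_cst.
  apply: continuous_subspaceT => x.
  apply: (@continuous_comp _ _ _ (fun z : plane => z - q') enorm); last exact: enorm_continuous.
  by apply: (@cvgB _ plane); [exact: cvg_id|exact: cvg_cst].
have cc (a : R) : {within closure Om, continuous (fun=> a : R)}.
  by move=> x; exact: cvg_cst.
have H1 q' : Om q' -> u p - u q' <= L * enorm (p - q').
  move=> Oq'; rewrite -subr_ge0.
  apply: (closure_ge0 Om (fun p => L * enorm (p - q') - (u p - u q')) _ _ p cp).
    by apply: within_continuousB => //; exact: within_continuousB.
  by move=> p' Op'; rewrite subr_ge0 H.
rewrite -subr_ge0 enormB.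
apply: (closure_ge0 Om (fun q => L * enorm (q - p) - (u p - u q)) _ _ q cq).
  by apply: within_continuousB => //; exact: within_continuousB.
by move=> q' Oq'; rewrite subr_ge0 enormB H1.
Qed.

Lemma lipschitz_of_gradient Om u (N : R) : open Om -> convex_domain Om -> C1 Om u ->
  (forall p, Om p -> Num.sqrt (dx u p ^+ 2 + dt u p ^+ 2) <= N) ->
  forall p q, Om p -> Om q -> u p - u q <= N * enorm (p - q).
Proof.
move=> oOm cOm cu HN p q Op Oq.
have Or t : 0 <= t <= 1 -> Om (ray q (p - q) t) by exact: convex_ray.
have D t : 0 <= t <= 1 -> _ := fun t01 => is_derive_ray Om u q (p - q) t oOm cu (Or t t01).
have [||t] := @MVT R (fun t => u (ray q (p - q) t)) (fun t => (p - q).1 * dx u (ray q (p - q) t)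
    + (p - q).2 * dt u (ray q (p - q) t)) 0 1 ltr01.
- by move=> t; rewrite in_itv /= => /andP[t0 t1]; apply: D; rewrite !ltW.
- apply: derivable_within_continuous => t; rewrite in_itv /= => t01.
  by have [] := D t t01.
rewrite in_itv /= => /andP[t0 t1]; rewrite subr0 mulr1 ray0.
have -> : ray q (p - q) 1 = p.
  by rewrite /ray !mul1r /= !subrKC -surjective_pairing.
move=> ->; apply: le_trans (cauchy_schwarz _ _ _ _) _.
rewrite mulrC ler_wpM2r ?sqrtr_ge0//; apply: HN; apply: Or; rewrite !ltW//.
Qed.

Lemma enorm_ray p w (t : R) : enorm (ray p w t - p) = `|t| * enorm w.
Proof.
rewrite /enorm /ray /= -sqrtr_sqr -sqrtrM ?sqr_ge0//; congr Num.sqrt; ring.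
Qed.

Lemma gradient_of_lipschitz Om u (N : R) : open Om -> C1 Om u -> 0 <= N ->
  (forall p q, Om p -> Om q -> u p - u q <= N * enorm (p - q)) ->
  forall p, Om p -> Num.sqrt (dx u p ^+ 2 + dt u p ^+ 2) <= N.
Proof.
(* The Lipschitz bound is tested in the direction of the gradient, giving |w|^2 <= N |w|. *)
move=> oOm cu N0 H p Op; pose w : plane := (dx u p, dt u p).
rewrite -[leLHS]/(enorm w).
suff : enorm w ^+ 2 <= N * enorm w.
  have := enorm_ge0 w; rewrite le_eqVlt => /predU1P[<- //|S0].
  by rewrite expr2 ler_pM2r.
apply/ler_addgt0Pr => e e0.
have /is_derive_littleo/(_ e e0) := @is_derive_ray0 R Om u p w oOm cu Op.
have -> : w.1 * dx u p + w.2 * dt u p = enorm w ^+ 2.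
  by rewrite /enorm sqr_sqrtr ?addr_ge0 ?sqr_ge0.
move=> D; have nO := near_ray Om p w oOm Op.
have /nbhs_ballP[r /= r0 br] : nbhs (0 : R) (fun t =>
    `|u (ray p w (0 + t)) - u (ray p w 0) - enorm w ^+ 2 * t| <= e * `|t| /\
    Om (ray p w t)) by exact: filterI.
have t0 : 0 < r / 2 by rewrite divr_gt0.
have [|h Ot] := br (r / 2).
  by rewrite /ball /= sub0r normrN gtr0_norm// ltr_pdivrMr// ltr_pMr// ltr1n.
have := H _ _ Ot Op; rewrite enorm_ray (gtr0_norm t0).
move: h; rewrite add0r ray0 (gtr0_norm t0) ler_norml => /andP[h _] h'.
by rewrite -(ler_pM2r t0); lra.
Qed.

Lemma ext_in Om h p : extends_continuously Om h -> Om p -> ext Om h p = h p.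
Proof.
move=> [h' ch' hh'] Op; rewrite (ext_closure Om h h' p ch' hh'); first exact: hh'.
exact: subset_closure.
Qed.

Lemma ext_continuous Om h : extends_continuously Om h ->
  {within closure Om, continuous (ext Om h)}.
Proof.
move=> [h' ch' hh']; apply: (subspace_eq_continuous _ ch') => p; rewrite inE => cp.
exact: (esym (ext_closure Om h h' p ch' hh' cp)).
Qed.

Lemma within_continuous_sqr Om u : {within closure Om, continuous u} ->
  {within closure Om, continuous (fun p => u p ^+ 2)}.
Proof.
move=> cu; apply: (within_continuous_comp _ _ (fun x => x ^+ 2)) => //.
exact: exprn_continuous.
Qed.

Lemma norm_D_continuous Om u : extends_continuously Om (dx u) ->
  extends_continuously Om (dt u) -> {within closure Om, continuous (norm_D Om u)}.
Proof.
move=> /ext_continuous c1 /ext_continuous c2.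
apply: (within_continuous_comp _
  (fun p => ext Om (dx u) p ^+ 2 + ext Om (dt u) p ^+ 2) Num.sqrt).
  exact: sqrt_continuous.
by apply: within_continuousD; exact: within_continuous_sqr.
Qed.

Lemma norm_D2_continuous Om u : extends_continuously Om (dx (dx u)) ->
  extends_continuously Om (dt (dx u)) -> extends_continuously Om (dx (dt u)) ->
  extends_continuously Om (dt (dt u)) ->
  {within closure Om, continuous (norm_D2 Om u)}.
Proof.
move=> /ext_continuous/within_continuous_sqr c1 /ext_continuous/within_continuous_sqr c2.
move=> /ext_continuous/within_continuous_sqr c3 /ext_continuous/within_continuous_sqr c4.
apply: (within_continuous_comp _
  (fun p => ext Om (dx (dx u)) p ^+ 2 + ext Om (dt (dx u)) p ^+ 2
    + ext Om (dx (dt u)) p ^+ 2 + ext Om (dt (dt u)) p ^+ 2) Num.sqrt).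
  exact: sqrt_continuous.
apply: within_continuousD c4; apply: within_continuousD c3.
exact: within_continuousD c1 c2.
Qed.

Lemma norm_D_in Om u p : extends_continuously Om (dx u) ->
  extends_continuously Om (dt u) -> Om p ->
  norm_D Om u p = Num.sqrt (dx u p ^+ 2 + dt u p ^+ 2).
Proof. by move=> e1 e2 Op; rewrite /norm_D (ext_in _ _ _ e1 Op) (ext_in _ _ _ e2 Op). Qed.

(* The equations keep unification from comparing entries of the Hessian. *)
Lemma entries_le_frobenius (a b b' c A B B' C : R) : A = a -> B = b -> B' = b' -> C = c ->
  [/\ `|a| <= Num.sqrt (A ^+ 2 + B ^+ 2 + B' ^+ 2 + C ^+ 2),
      `|b| <= Num.sqrt (A ^+ 2 + B ^+ 2 + B' ^+ 2 + C ^+ 2) &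
      `|c| <= Num.sqrt (A ^+ 2 + B ^+ 2 + B' ^+ 2 + C ^+ 2)].
Proof.
move=> -> -> -> ->.
have := sqr_ge0 a; have := sqr_ge0 b; have := sqr_ge0 b'; have := sqr_ge0 c.
by move=> *; rewrite -!sqrtr_sqr; split; apply: ler_wsqrtr; lra.
Qed.

Lemma norm_D2_entries Om u p : extends_continuously Om (dx (dx u)) ->
  extends_continuously Om (dt (dx u)) -> extends_continuously Om (dx (dt u)) ->
  extends_continuously Om (dt (dt u)) -> Om p ->
  [/\ `|dx (dx u) p| <= norm_D2 Om u p, `|dt (dx u) p| <= norm_D2 Om u p &
      `|dt (dt u) p| <= norm_D2 Om u p].
Proof.
move=> e1 e2 e3 e4 Op; pose E := fun h e => @ext_in Om h p e Op.
exact: (entries_le_frobenius _ _ _ _ _ _ _ _ (E _ e1) (E _ e2) (E _ e3) (E _ e4)).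
Qed.

Lemma max_on_le {T : Type} (A : set T) (F : T -> R) (b : R) : A !=set0 ->
  (forall z, A z -> F z <= b) -> max_on A F <= b.
Proof.
by move=> A0 H; apply: ge_sup; [exact: image_nonempty|move=> _ [z Az <-]; exact: H].
Qed.

End Lipschitz.

(** * Boundary estimate, explicit constants, and the global gradient bound *)

Section GradientBound.
Context {R : realType}.
Local Notation plane := (R * R)%type.
Implicit Types (Om : set plane) (u f g phi : plane -> R) (p q w : plane).
#[local] Opaque dx dt.

(** Normalized and turned inwards, the supporting line gives an affine function that is the distance
    to it on the closure. *)
Lemma unit_normal Om p : convex_domain Om -> bdry Om p -> exists n1 n2 c : R,
  [/\ n1 ^+ 2 + n2 ^+ 2 = 1, n1 * p.1 + n2 * p.2 + c = 0 &
      forall q, closure Om q -> 0 <= n1 * q.1 + n2 * q.2 + c].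
Proof.
move=> cOm bp; have [a [b [c [ab E H]]]] := cOm p bp.
pose rho := enorm ((a, b) : plane).
have rho0 : 0 < rho.
  rewrite lt_neqAle enorm_ge0 andbT eq_sym; apply/negP => /eqP r0.
  by move: ab; rewrite (enorm_eq0 _ r0) eqxx.
have rho2 : rho ^+ 2 = a ^+ 2 + b ^+ 2.
  by rewrite /rho /enorm sqr_sqrtr ?addr_ge0 ?sqr_ge0.
have rn : rho != 0 by rewrite gt_eqF.
exists (- a / rho), (- b / rho), (c / rho); split.
- have -> : (- a / rho) ^+ 2 + (- b / rho) ^+ 2 = (a ^+ 2 + b ^+ 2) / rho ^+ 2 by field.
  by rewrite -rho2 divff// expf_neq0.
- by rewrite -E; field.
move=> q cq; apply: (closure_ge0 Om (fun q => - a / rho * q.1 + - b / rho * q.2 + c / rho) _ _ q cq).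
  exact: continuous_affine.
move=> {cq} q /H h.
have -> : - a / rho * q.1 + - b / rho * q.2 + c / rho =
  (c - (a * q.1 + b * q.2)) / rho by field.
by rewrite divr_ge0 ?(ltW rho0)// subr_ge0 ltW.
Qed.

Lemma x_extentP (A : set plane) p q : compact A -> A p -> A q ->
  p.1 - q.1 <= x_extent A.
Proof.
move=> cA Ap Aq.
have cx : {within A, continuous (fst : plane -> R)}.
  by apply: continuous_subspaceT => x; exact: cvg_fst.
by apply: lerB; [exact: max_onP|exact: min_onP].
Qed.

Lemma x_centerP (A : set plane) : compact A -> exists x0 : R, forall p, A p ->
  (p.1 - x0) ^+ 2 <= (x_extent A / 2) ^+ 2.
Proof.
move=> cA; exists (min_on A fst + x_extent A / 2) => p Ap.
have cx : {within A, continuous (fst : plane -> R)}.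
  by apply: continuous_subspaceT => x; exact: cvg_fst.
have h1 := max_onP _ _ p cA cx Ap; have h2 := min_onP _ _ p cA cx Ap.
rewrite -[leLHS]real_normK ?num_real// lerXn2r ?nnegrE//.
  by apply: divr_ge0 => //; move: h1 h2; rewrite /x_extent; lra.
by rewrite ler_norml /x_extent; apply/andP; split; lra.
Qed.

(** The horizontal width is the only size of [Om] allowed in the constant, so the boundary is
    reached by a horizontal move. *)
Lemma horizontal_exit Om p : open Om -> compact (closure Om) -> Om p ->
  exists2 q, bdry Om q & enorm (p - q) <= x_extent (closure Om).
Proof.
move=> oOm cO Op; have cp : closure Om p by exact: subset_closure.
(* The excess 1 puts the endpoint outside the closure. *)
pose w : plane := (x_extent (closure Om) + 1, 0).
have [|t [t0 t1 bt]] := ray_exit Om p w oOm Op.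
  move=> /subset_closure cr; have := x_extentP _ _ p cO cr cp.
  by rewrite /ray /=; lra.
exists (ray p w t) => //; have [cr _] := bt.
have h := x_extentP _ _ _ cO cr cp; have h' := x_extentP _ _ _ cO cp cp.
rewrite enormB enorm_ray ger0_norm//.
move: h; rewrite /ray /enorm /= expr0n /= addr0 sqrtr_sqr ger0_norm; lra.
Qed.

Lemma bdry_nonempty Om : open Om -> compact (closure Om) -> Om !=set0 -> bdry Om !=set0.
Proof. by move=> oOm cO [p Op]; have [q bq _] := horizontal_exit Om p oOm cO Op; exists q. Qed.

Lemma bdry_compact Om : compact (closure Om) -> compact (bdry Om).
Proof.
move=> cO; apply: (subclosed_compact _ cO); last by move=> p [].
rewrite /bdry setDE; apply: closedI; first exact: closed_closure.
by apply: open_closedC; exact: open_interior.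
Qed.

(** Determinant over trace of diag(m^2, 1): an explicit number below both m^2 and 1, playing the
    part of [mu] in the estimates. *)
Definition trace_ratio (m : R) := m ^+ 2 / (1 + m ^+ 2).

(** The final 1 makes the inequality required of [nu] strict. *)
Definition barrier_rate (m M K : R) :=
  (K * (M ^+ 2 + 6 + 4 * K ^+ 2) + M * (3 + 2 * K ^+ 2) + 1) / trace_ratio m.

(** 2 M + K W bounds |g - phi| in [Om]; the last K is the Lipschitz constant of phi. *)
Definition boundary_lipschitz_const (m M W K : R) :=
  expR (barrier_rate m M K * (2 * M + K * W)) + K.

(** M^2 carries the boundary constant from g to g^3/3, and the quotient is the threshold of the
    halving step. The final 1 gives L >= 1, so that mu L^2 >= mu L exceeds that threshold. *)
Definition cube_lipschitz_const (m M W K : R) :=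
  M ^+ 2 * boundary_lipschitz_const m M W K +
  (7 * M ^+ 6 + (6 * M ^+ 5 + 4 * M ^+ 3) ^+ 2 / (2 * trace_ratio m)) / trace_ratio m
  + 1.

(** Mf + W bounds g, and the division returns from g^3/3 to g, since [trace_ratio m] <= m^2. *)
Definition gradient_const (m Mf W K : R) :=
  cube_lipschitz_const m (Mf + W) W K / trace_ratio m.

Lemma trace_ratioP (m : R) : 0 < m ->
  [/\ 0 < trace_ratio m, trace_ratio m <= 1 & trace_ratio m <= m ^+ 2].
Proof.
move=> m0; have m2 : 0 < m ^+ 2 by rewrite exprn_gt0.
have d0 : 0 < 1 + m ^+ 2 by rewrite addr_gt0.
rewrite /trace_ratio; split; first by rewrite divr_gt0.
  by rewrite ler_pdivrMr// mul1r lerDr.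
by rewrite ler_pdivrMr// ler_pMr// lerDl ltW.
Qed.

(** Each boundary point p has its own barrier, built on the supporting line at p: the distance from
    q to that line is at most |q - p|. *)
Lemma boundary_lipschitz Om g phi (eps l m M K : R) :
  open Om -> compact (closure Om) -> convex_domain Om ->
  {within closure Om, continuous g} -> C2 Om g -> hyperbolic_eq eps l Om g ->
  0 <= eps -> eps <= 1 -> 0 <= l -> l <= 1 -> 0 < m ->
  (forall p, closure Om p -> m <= g p) -> (forall p, closure Om p -> g p <= M) ->
  {within closure Om, continuous phi} -> C2 Om phi -> 0 <= K ->
  (forall p, Om p -> Num.sqrt (dx phi p ^+ 2 + dt phi p ^+ 2) <= K) ->
  (forall p, Om p -> [/\ `|dx (dx phi) p| <= K, `|dt (dx phi) p| <= K &
                         `|dt (dt phi) p| <= K]) ->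
  (forall p, bdry Om p -> g p = phi p) ->
  forall p q, bdry Om p -> closure Om q ->
    `|g q - g p| <=
      boundary_lipschitz_const m M (x_extent (closure Om)) K * enorm (q - p).
Proof.
move=> oOm cO cOm cg g2 geq eps0 eps1 l0 l1 m0 gm gM cphi phi2 K0 HK HK2 gphi p q bp cq.
have [mu0 mu1 mum] := trace_ratioP m m0.
set nu := barrier_rate m M K; set W := x_extent _; set D0 := 2 * M + K * W.
have cp : closure Om p by case: bp.
have M0 : 0 < M by apply: (lt_le_trans m0); apply: le_trans (gm _ cp) (gM _ cp).
have phiL : forall a b, closure Om a -> closure Om b -> phi a - phi b <= K * enorm (a - b).
  apply: closure_lipschitz => //; apply: lipschitz_of_gradient => //.
  by case: phi2.
have phiN a b : closure Om a -> closure Om b -> `|phi a - phi b| <= K * enorm (a - b).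
  by move=> ca cb; rewrite ler_norml lerNl opprB phiL// enormB phiL.
have numer0 : 0 < K * (M ^+ 2 + 6 + 4 * K ^+ 2) + M * (3 + 2 * K ^+ 2) + 1.
  have h1 := sqr_ge0 M; have h2 := sqr_ge0 K.
  have h3 : 0 <= K * (M ^+ 2 + 6 + 4 * K ^+ 2) by apply: mulr_ge0 => //; lra.
  have h4 : 0 <= M * (3 + 2 * K ^+ 2) by apply: mulr_ge0; lra.
  by lra.
have nu0 : 0 < nu by rewrite /nu /barrier_rate divr_gt0.
have nuE : nu * trace_ratio m =
    K * (M ^+ 2 + 6 + 4 * K ^+ 2) + M * (3 + 2 * K ^+ 2) + 1.
  by rewrite /nu /barrier_rate divfK// gt_eqF.
(* At the horizontal exit point b one has g = phi; going from a to b changes g by at most 2 M and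
   phi by at most K W. *)
have far a : Om a -> `|g a - phi a| <= D0.
  move=> Oa; have ca : closure Om a by exact: subset_closure.
  have [b bb ab] := horizontal_exit Om a oOm cO Oa; have cb : closure Om b by case: bb.
  have h1 := phiN a b ca cb; have h2 : K * enorm (a - b) <= K * W by exact: ler_wpM2l.
  have := gm a ca; have := gM a ca; have := gm b cb; have := gM b cb.
  move: h1; rewrite (gphi b bb) !ler_norml => /andP[? ?] ? ? ? ?.
  by rewrite /D0; apply/andP; split; lra.
have [n1 [n2 [c [n12 np nq]]]] := unit_normal Om p cOm bp.
have bar sg : `|sg| = 1 ->
    sg * (g q - phi q) <= expR (nu * D0) * (n1 * q.1 + n2 * q.2 + c).
  move=> sg1; apply: (@boundary_barrier R Om g eps l oOm cO cg g2 _ eps0 l0 l1 geq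
    phi K M (trace_ratio m) nu D0 n1 n2 c sg) => //.
  - by move=> a /subset_closure/gm; exact: lt_le_trans.
  - move=> a Oa; have h := HK a Oa.
    rewrite -[leLHS](sqr_sqrtr (addr_ge0 (sqr_ge0 _) (sqr_ge0 _))).
    by rewrite lerXn2r ?nnegrE ?sqrtr_ge0.
  - move=> a /subset_closure/gm h; apply: le_trans mum _.
    by rewrite lerXn2r ?nnegrE ?(ltW m0)// (le_trans (ltW m0)).
  - by move=> a /subset_closure/gM.
  - by rewrite nuE; lra.
  - by move=> a Oa; apply: le_trans (ler_norm _) _; rewrite normrM sg1 mul1r far.
have dq : n1 * q.1 + n2 * q.2 + c <= enorm (q - p).
  have -> : n1 * q.1 + n2 * q.2 + c = n1 * (q - p).1 + n2 * (q - p).2.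
    by rewrite -[LHS]subr0 -np /=; ring.
  apply: le_trans (cauchy_schwarz _ _ _ _) _.
  by rewrite n12 sqrtr1 mul1r.
have eD : 0 <= expR (nu * D0) by exact: expR_ge0.
have h1 := ler_wpM2l eD dq.
have := bar 1 (normr1 _); have := bar (-1) (normrN1 _); have := phiN q p cq cp.
rewrite (gphi p bp) /boundary_lipschitz_const -/nu -/W -/D0 !ler_norml.
move: (expR _) h1 => E h1 /andP[? ?] ? ?; apply/andP; split; lra.
Qed.

Lemma cube_diff_le (a b m M : R) : 0 < m -> m <= a -> a <= M -> m <= b -> b <= M ->
  a ^+ 3 / 3 - b ^+ 3 / 3 <= M ^+ 2 * `|a - b|.
Proof.
move=> m0 ma aM mb bM.
have -> : a ^+ 3 / 3 - b ^+ 3 / 3 = (a ^+ 2 + a * b + b ^+ 2) / 3 * (a - b) by field.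
apply: le_trans (ler_norm _) _; rewrite normrM; apply: ler_wpM2r => //.
have h1 : a * a <= M * M by apply: ler_pM; lra.
have h2 : a * b <= M * M by apply: ler_pM; lra.
have h3 : b * b <= M * M by apply: ler_pM; lra.
have h4 : 0 <= a * b by apply: mulr_ge0; lra.
rewrite ger0_norm; first by lra.
by apply: divr_ge0 => //; have := sqr_ge0 a; have := sqr_ge0 b; lra.
Qed.

Lemma gradient_bound Om g phi (eps l m M K : R) :
  open Om -> compact (closure Om) -> convex_domain Om -> Om !=set0 ->
  {within closure Om, continuous g} -> C2 Om g -> hyperbolic_eq eps l Om g ->
  extends_continuously Om (dx g) -> extends_continuously Om (dt g) ->
  0 <= eps -> eps <= 1 -> 0 <= l -> l <= 1 -> 0 < m ->
  (forall p, closure Om p -> m <= g p) -> (forall p, closure Om p -> g p <= M) ->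
  {within closure Om, continuous phi} -> C2 Om phi -> 0 <= K ->
  (forall p, Om p -> Num.sqrt (dx phi p ^+ 2 + dt phi p ^+ 2) <= K) ->
  (forall p, Om p -> [/\ `|dx (dx phi) p| <= K, `|dt (dx phi) p| <= K &
                         `|dt (dt phi) p| <= K]) ->
  (forall p, bdry Om p -> g p = phi p) ->
  max_on (closure Om) (norm_D Om g) <=
    cube_lipschitz_const m M (x_extent (closure Om)) K / trace_ratio m.
Proof.
move=> oOm cO cOm [p0 Op0] cg g2 geq egx egt eps0 eps1 l0 l1 m0 gm gM cphi phi2 K0
  HK HK2 gphi.
have cp0 : closure Om p0 by exact: subset_closure.
have [mu0 mu1 mum] := trace_ratioP m m0.
have M0 : 0 < M by apply: (lt_le_trans m0); apply: le_trans (gm _ cp0) (gM _ cp0).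
have HB := boundary_lipschitz Om g phi eps l m M K oOm cO cOm cg g2 geq eps0 eps1 l0 l1
  m0 gm gM cphi phi2 K0 HK HK2 gphi.
set W := x_extent _ in HB *.
have B0 : 0 <= boundary_lipschitz_const m M W K by rewrite addr_ge0 ?expR_ge0.
rewrite /cube_lipschitz_const.
move: (boundary_lipschitz_const m M W K) B0 HB => B B0 HB {W}.
move: (trace_ratio m) mu0 mu1 mum => mu mu0 mu1 mum.
have N0 : 0 <= 7 * M ^+ 6 + (6 * M ^+ 5 + 4 * M ^+ 3) ^+ 2 / (2 * mu).
  apply: addr_ge0; first by rewrite mulr_ge0// exprn_ge0// ltW.
  by apply: divr_ge0; rewrite ?sqr_ge0// mulr_ge0// ltW.
have Nmu0 := divr_ge0 N0 (ltW mu0).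
have MB0 : 0 <= M ^+ 2 * B by rewrite mulr_ge0 ?sqr_ge0.
set L := M ^+ 2 * B + _ / mu + 1.
have L1 : 1 <= L by rewrite lerDr addr_ge0.
have LN : 7 * M ^+ 6 + (6 * M ^+ 5 + 4 * M ^+ 3) ^+ 2 / (2 * mu) < mu * L.
  rewrite [mu * L]mulrC -ltr_pdivrMr//; rewrite /L.
  by move: MB0; move: (_ / mu) (M ^+ 2 * B) => a b; lra.
have LB : M ^+ 2 * B <= L by rewrite /L -addrA lerDl addr_ge0.
clearbody L.
pose lip L' := forall p q, closure Om p -> closure Om q ->
  g p ^+ 3 / 3 - g q ^+ 3 / 3 <= L' * enorm (p - q).
(* The gradient extends continuously to the compact closure, so some Lipschitz constant exists. It
   only fixes the number k of halvings. *)
have [k lipk] : exists k : nat, lip (2 ^+ k * L).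
  have cN := norm_D_continuous Om g egx egt.
  pose N := max_on (closure Om) (norm_D Om g).
  have gL : forall p q, closure Om p -> closure Om q -> g p - g q <= N * enorm (p - q).
    apply: closure_lipschitz => //; apply: lipschitz_of_gradient => //; first by case: g2.
    move=> p Op; rewrite -(norm_D_in Om g p egx egt Op).
    by apply: max_onP => //; exact: subset_closure.
  pose k := Num.bound `|M ^+ 2 * N|; exists k => p q cp cq.
  apply: (le_trans (cube_diff_le _ _ m M m0 (gm p cp) (gM p cp) (gm q cq) (gM q cq))).
  have gN : `|g p - g q| <= N * enorm (p - q).
    by rewrite ler_norml lerNl opprB gL// enormB gL.
  apply: le_trans (ler_wpM2l (sqr_ge0 M) gN) _.
  rewrite mulrA; apply: ler_wpM2r; first exact: enorm_ge0.
  have kb : M ^+ 2 * N <= k%:R.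
    by apply: le_trans (ler_norm _) _; exact: ltW (archi_boundP (normr_ge0 _)).
  apply: le_trans kb _; apply: (@le_trans _ _ (2 ^+ k)).
    by rewrite -natrX ler_nat ltnW// ltn_expl.
  by rewrite ler_peMr// exprn_ge0.
have {k lipk}lipL : lip L.
  (* Each step goes from 2 (2^k L) down to 2^k L, which is still above the threshold and above the
     boundary constant. *)
  elim: k lipk => [|k IH]; first by rewrite expr0 mul1r.
  rewrite exprS -mulrA => lipk; apply: IH.
  have k1 : 1 <= (2 : R) ^+ k by rewrite exprn_ege1// ler1n.
  have kL : L <= 2 ^+ k * L by rewrite ler_peMl// (le_trans ler01).
  apply: (lipschitz_halving Om g eps l (2 ^+ k * L) m M mu) => //.
  - by rewrite mulr_gt0 ?exprn_gt0//; lra.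
  - apply: (lt_le_trans LN); rewrite ler_pM2l//; apply: (le_trans kL).
    by rewrite expr2 ler_peMl//; lra.
  - move=> p q cp cq bpq.
    apply: (le_trans (cube_diff_le _ _ m M m0 (gm p cp) (gM p cp) (gm q cq) (gM q cq))).
    have gB : `|g p - g q| <= B * enorm (p - q).
      by case: bpq => b; [rewrite distrC enormB|]; exact: HB.
    apply: le_trans (ler_wpM2l (sqr_ge0 M) gB) _.
    rewrite mulrA; apply: ler_wpM2r; first exact: enorm_ge0.
    exact: le_trans LB kL.
have L0 : 0 <= L / mu by rewrite divr_ge0 ?(ltW mu0)//; lra.
have gLip p q : Om p -> Om q -> g p - g q <= L / mu * enorm (p - q).
  move=> /subset_closure cp /subset_closure cq.
  have [h|h] := leP (g p) (g q).
    apply: (@le_trans _ _ 0); first by rewrite subr_le0.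
    by rewrite mulr_ge0// enorm_ge0.
  rewrite mulrAC ler_pdivlMr//; apply: le_trans (lipL p q cp cq).
  have -> : g p ^+ 3 / 3 - g q ^+ 3 / 3 =
    (g p - g q) * ((g p ^+ 2 + g p * g q + g q ^+ 2) / 3) by field.
  rewrite ler_pM2l ?subr_gt0//; apply: (le_trans mum).
  have a := gm p cp; have b := gm q cq.
  have h1 : m * m <= g p * g p by apply: ler_pM; lra.
  have h2 : m * m <= g p * g q by apply: ler_pM; lra.
  have h3 : m * m <= g q * g q by apply: ler_pM; lra.
  lra.
apply: max_on_le; first by exists p0.
move=> p cp; rewrite -subr_ge0.
apply: (closure_ge0 Om (fun p => L / mu - norm_D Om g p) _ _ p cp).
  apply: within_continuousB; first by move=> x; exact: cvg_cst.
  exact: norm_D_continuous.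
move=> q Oq; rewrite subr_ge0 norm_D_in//.
by apply: (gradient_of_lipschitz Om) => //; case: g2.
Qed.

End GradientBound.

(** * From the boundary data to the explicit constant *)

Theorem theorem5p2 (R : realType) :
  exists C : R -> R -> R -> R -> R,
  forall (alpha : R) (Om : set (R * R)) (f : R * R -> R)
         (eps : R) (ell : R -> R) (phi : R -> R * R -> R) (K : R)
         (s : R) (g : R * R -> R),
    0 < alpha -> alpha < 1 ->
    bounded_C2alpha_domain alpha Om ->
    convex_domain Om ->
    C2alpha_bdry alpha Om f ->
    (forall p, bdry Om p -> 0 < f p) ->
    0 <= eps -> eps <= 1 ->
    {within `[0, 1], continuous ell} ->
    (forall r, 0 <= r <= 1 -> 0 <= ell r <= 1) ->
    ell 1 = 1 ->
    (forall r, 0 <= r <= 1 / 2 -> ell r = 0) ->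
    (forall r, 1 / 2 <= r <= 1 -> solves_euclidean alpha Om f r (phi r)) ->
    (forall r, 1 / 2 <= r <= 1 ->
       max_on (closure Om) (norm_D Om (phi r))
       + max_on (closure Om) (norm_D2 Om (phi r)) <= K) ->
    1 / 2 <= s <= 1 ->
    C2alpha_closure alpha Om g ->
    (forall p, Om p -> 0 < g p) ->
    hyperbolic_eq eps (ell s) Om g ->
    (forall p, bdry Om p -> g p = bdry_data Om f s p) ->
    Rradius Om f <= min_on (bdry Om) f
                    + min_on (bdry Om) f * Num.sqrt (pi / 2) ->
    max_on (closure Om) (norm_D Om g)
      <= C (min_on (bdry Om) f) (max_on (bdry Om) f)
           (x_extent (closure Om)) K.
Proof.
exists gradient_const.
move=> alpha Om f eps ell phi K s g alpha0 alpha1 [ne0 oOm Oc bO Och] cOm fC f0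
  eps0 eps1 ellc ellb ell1 ell0 phis phiK s12 gC g0 geq gf Rf.
have cO := bounded_compact_closure _ bO.
have bc := bdry_compact _ cO.
have b0 := bdry_nonempty _ oOm cO ne0.
have bW F : {within closure Om, continuous F} -> {within bdry Om, continuous (F : R * R -> R)}.
  by apply: continuous_subspaceW => p [].
have r1 : 1 / 2 <= (1 : R) <= 1 by apply/andP; split; lra.
(* At r = 1 the boundary data reduce to f, which inherits its continuity from [phi 1]. *)
have cf : {within bdry Om, continuous f}.
  have [[c1 _ _ _ _ _ _] _ E] := phis 1 r1.
  apply: (subspace_eq_continuous _ (bW _ c1)) => p; rewrite inE => bp.
  by have := E p bp; rewrite /from_subspace /bdry_data => ->; ring.
have m0 := min_on_gt0 _ _ b0 bc cf f0.
have fm p : bdry Om p -> min_on (bdry Om) f <= f p by exact: min_onP.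
have fM p : bdry Om p -> f p <= max_on (bdry Om) f by exact: max_onP.
(* The weights 2 s - 1 and 2 (1 - s) are nonnegative and add up to 1. *)
have gm' p : bdry Om p -> min_on (bdry Om) f <= g p <= max_on (bdry Om) f.
  move=> bp; rewrite gf// /bdry_data.
  have h1 := fm p bp; have h2 := fM p bp; move: h1 h2 s12.
  move: (min_on _ _) (max_on _ _) (f p) => m M fp h1 h2 /andP[s1 s2].
  have h3 : (2 * s - 1) * m <= (2 * s - 1) * fp by apply: ler_wpM2l => //; lra.
  have h4 : (2 * s - 1) * fp <= (2 * s - 1) * M by apply: ler_wpM2l => //; lra.
  have h5 : 2 * (1 - s) * m <= 2 * (1 - s) * M by apply: ler_wpM2l; lra.
  by apply/andP; split; lra.
have s01 : 0 <= s <= 1 by move: s12 => /andP[? ?]; apply/andP; split; lra.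
have /andP[l0 l1] := ellb s s01.
have g2 := C2alpha_closureC2 _ _ _ oOm gC.
have [cg _ _ _ [eg1 eg2] _ _] := gC.
have gm p : closure Om p -> min_on (bdry Om) f <= g p.
  by apply: (lower_bound _ _ _ _ oOm cO cg g2 g0 eps0 l0 geq) => q /gm'/andP[].
have [x0 Hx0] := x_centerP _ cO.
set W := x_extent (closure Om) in Hx0 *.
(* With x0 in the middle of the width, g^2 <= (max f)^2 + (W/2)^2 <= (max f + W)^2. *)
have gM p : closure Om p -> g p <= max_on (bdry Om) f + W.
  move=> cp; have W0 : 0 <= W by have := x_extentP _ p p cO cp cp; rewrite subrr.
  have [q bq] := b0; have Mf0 : 0 <= max_on (bdry Om) f.
    exact: le_trans (ltW (f0 q bq)) (fM q bq).
  have := upper_bound Om g eps (ell s) oOm cO cg g2 g0 eps0 l1 geq x0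
    (max_on (bdry Om) f ^+ 2 + (W / 2) ^+ 2).
  move=> /(_ _ p cp) H.
  have {}H : g p ^+ 2 + (p.1 - x0) ^+ 2 <= max_on (bdry Om) f ^+ 2 + (W / 2) ^+ 2.
    apply: H => z bz; apply: lerD; last by apply: Hx0; case: bz.
    have /andP[h1 h2] := gm' z bz.
    by rewrite lerXn2r ?nnegrE// (le_trans (ltW m0)).
  rewrite -(@ler_pXn2r _ 2) ?nnegrE//; last exact: addr_ge0 Mf0 W0.
    have := sqr_ge0 (p.1 - x0); have := mulr_ge0 Mf0 W0; have := sqr_ge0 W; lra.
  exact: le_trans (ltW m0) (gm p cp).
have [pC _ gphi'] := phis s s12.
have p2 := C2alpha_closureC2 _ _ _ oOm pC.
have [cphi _ _ _ [e1 e2] [h1 h2 h3 h4] _] := pC.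
have cN := norm_D_continuous _ _ e1 e2.
have cN2 := norm_D2_continuous _ _ h1 h2 h3 h4.
have KK := phiK s s12.
have [p0 Op0] := ne0; have cp0 := subset_closure Op0.
(* Both maxima being nonnegative, K bounds each of them separately. *)
have N0 : 0 <= max_on (closure Om) (norm_D Om (phi s)).
  by apply: le_trans (max_onP _ _ _ cO cN cp0); exact: sqrtr_ge0.
have N20 : 0 <= max_on (closure Om) (norm_D2 Om (phi s)).
  by apply: le_trans (max_onP _ _ _ cO cN2 cp0); exact: sqrtr_ge0.
apply: (gradient_bound Om g (phi s) eps (ell s) (min_on (bdry Om) f)
  (max_on (bdry Om) f + W) K) => //.
- exact: le_trans (addr_ge0 N0 N20) KK.
- move=> p Op; rewrite -(norm_D_in _ _ _ e1 e2 Op).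
  exact: le_trans (ler_wpDr N20 (max_onP _ _ _ cO cN (subset_closure Op))) KK.
- move=> p Op; have Kp : norm_D2 Om (phi s) p <= K.
    exact: le_trans (ler_wpDl N0 (max_onP _ _ _ cO cN2 (subset_closure Op))) KK.
  have [A B C] := norm_D2_entries _ _ _ h1 h2 h3 h4 Op.
  by split; [exact: le_trans A Kp|exact: le_trans B Kp|exact: le_trans C Kp].
- by move=> p bp; rewrite gf// gphi'.
Qed.
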